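(* Let $\mathcal{X}$ be a finite set, $\mathcal{H}$ a finite-dimensional Hilbert space, and $W:\mathcal{X}\to\mathcal{S}(\mathcal{H})$, $x\mapsto W_x$, a classical-quantum channel. Then for every $\epsilon\in(0,1)$, \[ R(W)=R_\epsilon(W)=C(W):=\sup_{p\in\mathcal{P}(\mathcal{X})} I(X;B)_{W\times p}. \]
   Context: $\mathcal{S}(\mathcal{H})$ is the set of density matrices on $\mathcal{H}$ and $\mathcal{P}(\mathcal{X})$ the set of probability distributions on $\mathcal{X}$. For $p\in\mathcal{P}(\mathcal{X})$, $W(p):=\sum_x p(x)W_x$ and $I(X;B)_{W\times p}:=\sum_x p(x)D(W_x\|W(p))$, where $D(\rho\|\sigma)=\mathrm{Tr}\,\rho(\log\rho-\log\sigma)$; all logarithms are base 2. For $n\ge1$ and $x^n=(x_1,\dots,x_n)\in\mathcal{X}^n$ let $W^{\otimes n}_{x^n}:=W_{x_1}\otimes\cdots\otimes W_{x_n}$ and, for a distribution $p^n$ on $\mathcal{X}^n$, $W^{\otimes n}(p^n):=\sum_{x^n}p^n(x^n)W^{\otimes n}_{x^n}$. For a positive integer $M$, $\mathcal{P}_M(\mathcal{X}^n)$ is the set of distributions $q$ on $\mathcal{X}^n$ with $Mq(x^n)\in\mathbb{Z}$ for all $x^n$. Define the worst-case resolution error \[ \varepsilon(W^{\otimes n},M):=\sup_{p^n\in\mathcal{P}(\mathcal{X}^n)}\inf_{q^n\in\mathcal{P}_M(\mathcal{X}^n)}\tfrac12\|W^{\otimes n}(p^n)-W^{\otimes n}(q^n)\|_1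 . \] The worst-input resolvability rate is $R(W):=\inf\{R>0:\ \forall\gamma>0,\ \liminf_{n\to\infty}\varepsilon(W^{\otimes n},\lfloor 2^{n(R+\gamma)}\rfloor)=0\}$. For $\epsilon\in(0,1)$, $M_\epsilon(W^{\otimes n}):=\min\{M\in\mathbb{N}_+:\varepsilon(W^{\otimes n},M)\le\epsilon\}$ and $R_\epsilon(W):=\liminf_{n\to\infty}\frac1n\log M_\epsilon(W^{\otimes n})$. *)

(* Defs.v *)
From HB Require Import structures.
From mathcomp Require Import all_boot all_order all_algebra.
From mathcomp Require Import all_classical all_reals all_analysis.
From mathcomp Require Import complex mxtens.
Set Implicit Arguments. Unset Strict Implicit. Unset Printing Implicit Defensive.
Import Order.TTheory GRing.Theory Num.Theory.
Local Open Scope ring_scope.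
Local Open Scope classical_set_scope.
Local Open Scope complex_scope.

Section QDefs.
Variable R : realType.
Local Notation C := (R[i]).

Definition adj m n (A : 'M[C]_(m, n)) : 'M[C]_(n, m) := map_mx (@conjc R) A^T.

Definition psd d (A : 'M[C]_d) : Prop :=
  forall v : 'cV[C]_d, 0 <= (adj v *m A *m v) 0 0.
Definition density d (A : 'M[C]_d) : Prop := psd A /\ \tr A = 1.

Definition spec_dec d (A : 'M[C]_d) (U : 'M[C]_d) (l : 'rV[R]_d) : Prop :=
  U *m adj U = 1%:M /\
  A = U *m diag_mx (map_mx (fun r => r%:C) l) *m adj U.

Definition hfun d (f : R -> R) (A : 'M[C]_d) : 'M[C]_d :=
  match pselect (exists Ul : 'M[C]_d * 'rV[R]_d, spec_dec A Ul.1 Ul.2) with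
  | left h => let Ul := projT1 (cid h) in
      Ul.1 *m diag_mx (map_mx (fun r => (f r)%:C) Ul.2) *m adj Ul.1
  | right _ => 0
  end.

Definition log2 (x : R) : R := ln x / ln 2.
Definition mlog d (A : 'M[C]_d) : 'M[C]_d :=
  hfun (fun t => if t == 0 then 0 else log2 t) A.

(* quantum relative entropy, +oo unless supp rho <= supp sigma *)
Definition relent d (rho sigma : 'M[C]_d) : \bar R :=
  if `[< forall v : 'cV[C]_d, sigma *m v = 0 -> rho *m v = 0 >]
  then (@complex.Re R (\tr (rho *m (mlog rho - mlog sigma))))%:E
  else +oo%E.

Definition trnorm d (A : 'M[C]_d) : R := @complex.Re R (\tr (hfun Num.sqrt (adj A *m A))).

Definition prob (T : finType) : set {ffun T -> R} :=
  [set p | (forall t, 0 <= p t) /\ \sum_t p t = 1].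
Arguments prob T : clear implicits.
Definition probM (T : finType) (M : nat) : set {ffun T -> R} :=
  [set q | prob T q /\ forall t, (M%:R * q t) \is a Num.int].
Arguments probM T M : clear implicits.

Variable X : finType.
Variable d : nat.

Definition avg (W : X -> 'M[C]_d) (p : {ffun X -> R}) : 'M[C]_d :=
  \sum_x (p x)%:C *: W x.

Definition mutinf (W : X -> 'M[C]_d) (p : {ffun X -> R}) : \bar R :=
  (\sum_(x : X) (p x)%:E * relent (W x) (avg W p))%E.

Definition capacity (W : X -> 'M[C]_d) : \bar R :=
  ereal_sup [set mutinf W p | p in prob X].

Fixpoint tens_fam (n : nat) : ('I_n -> 'M[C]_d) -> 'M[C]_(d ^ n) :=
  match n return ('I_n -> 'M[C]_d) -> 'M[C]_(d ^ n) with
  | 0 => fun _ => castmx (esym (expn0 d), esym (expn0 d)) 1%:M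
  | n'.+1 => fun g => castmx (esym (expnS d n'), esym (expnS d n'))
                         (tensmx (g ord0) (tens_fam (fun i => g (lift ord0 i))))
  end.

Definition Wn (W : X -> 'M[C]_d) (n : nat) (xn : {ffun 'I_n -> X}) : 'M[C]_(d ^ n) :=
  tens_fam (fun i => W (xn i)).

Definition avgn (W : X -> 'M[C]_d) (n : nat) (pn : {ffun {ffun 'I_n -> X} -> R})
  : 'M[C]_(d ^ n) := \sum_xn (pn xn)%:C *: Wn W xn.

Definition res_err (W : X -> 'M[C]_d) (n M : nat) : R :=
  sup [set inf [set trnorm (avgn W pn - avgn W qn) / 2 | qn in probM {ffun 'I_n -> X} M]
      | pn in prob {ffun 'I_n -> X}].

(* worst-input resolvability rate R(W) (liminf taken over n >= 1) *)
Definition res_rate (W : X -> 'M[C]_d) : \bar R :=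
  ereal_inf [set r%:E | r in [set r : R | 0 < r /\ forall g : R, 0 < g ->
     limn_einf (fun n => (res_err W n.+1
        (Num.truncn (2 `^ (n.+1%:R * (r + g)))))%:E) = 0%E]].

Definition Meps (W : X -> 'M[C]_d) (eps : R) (n : nat) : nat :=
  match pselect (exists M : nat, (0 < M)%N /\ res_err W n M <= eps) with
  | left h => ex_minn (P := fun M => `[< (0 < M)%N /\ res_err W n M <= eps >])
               (let: ex_intro M HM := h in ex_intro _ M (asboolT HM))
  | right _ => 0%N
  end.

(* R_eps(W) (liminf taken over n >= 1) *)
Definition res_rate_eps (W : X -> 'M[C]_d) (eps : R) : \bar R :=
  limn_einf (fun n => (log2 (Meps W eps n.+1)%:R / n.+1%:R)%:E).

End QDefs.

(* Main.v *)
Require Import Defs.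
From HB Require Import structures.
From mathcomp Require Import all_boot all_order all_algebra.
From mathcomp Require Import all_classical all_reals all_analysis.
From mathcomp Require Import complex mxtens.
From mathcomp Require Import spectral.
From mathcomp Require Import ring lra zify.
Import Order.TTheory GRing.Theory Num.Theory.
Local Open Scope ring_scope.
Set Implicit Arguments. Unset Strict Implicit. Unset Printing Implicit Defensive.

(** Both rates are squeezed against the capacity [C].

    Achievability.  Split an arbitrary input law on [X^n] according to the
    (polynomially many) types.  For inputs of type [P], cutting [W^n_{x^n}] to
    its eigenvalues at most [2^(-n(H(B|P) - D))] and compressing it by the
    spectral projection of [W(P)^{(x)n}] for eigenvalues at least
    [2^(-n(H(W(P)) + D))] changes little, by Chebyshev's inequality and gentle
    measurement.  For [M] independent samples, the Hilbert-Schmidt variance of the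
    cut states and Cauchy-Schwarz on the range of the projection bound the
    trace distance by about [2^(n (I(P) + 2D) / 2) / sqrt M], and [I(P) <= C]
    since [P] is itself an input law.  No minimax property of [C] is needed.

    Strong converse.  Let [rho_f] be the uniform mixture of [N] output states
    whose inputs are drawn independently from [p^n], and fix one candidate
    [om = W^n(q)].  If [rho_f] and [om] are not almost orthogonal, then [rho_f]
    must have constant weight on the spectral projection [Q = {om >= tau}]: the
    part of [om] outside [Q] has eigenvalues below [tau], while [rho_f]
    essentially lives on [N 2^(n H(B|X))] dimensions.  As [Q] has rank at most
    [1 / tau], much less than [2^(n H(B))], this weight has vanishing
    expectation, so by Chernoff's bound it is constant with probability at most
    [exp (- N / 2)].  A union bound over the at most [|X|^(n M)] laws [q] with
    denominator [M] leaves some [f] far from all of them as long as [N] exceeds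
    [n M] exponentially, for any [N] below [2^(n I(p))]. *)

(** * Hermitian matrices, spectral calculus and the trace norm *)

Section Matrices.
Local Open Scope complex_scope.
Variable R : realType.
Local Notation C := (R[i]).
Local Notation Re := (@complex.Re R).
Local Notation Im := (@complex.Im R).

Definition rtr d (A : 'M[C]_d) : R := Re (\tr A).

(** The real part of the Hilbert-Schmidt inner product, in real coordinates so that its variance
    splits into variances of real scalars. *)
Definition hsip m n (A B : 'M[C]_(m, n)) : R :=
  \sum_i \sum_j (Re (A i j) * Re (B i j) + Im (A i j) * Im (B i j)).

(** States and spectral projections are carried in this form: products, traces and thresholds become
    operations on [w]. *)
Definition udu d (U : 'M[C]_d) (w : 'I_d -> R) : 'M[C]_d :=
  U *m diag_mx (\row_a (w a)%:C) *m adj U.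

Lemma ReD (x y : C) : Re (x + y) = Re x + Re y.
Proof. by case: x; case: y. Qed.
Lemma ImD (x y : C) : Im (x + y) = Im x + Im y.
Proof. by case: x; case: y. Qed.
Lemma ReM (x y : C) : Re (x * y) = Re x * Re y - Im x * Im y.
Proof. by case: x; case: y. Qed.
Lemma ImM (x y : C) : Im (x * y) = Re x * Im y + Im x * Re y.
Proof. by case: x => a b; case: y => c e. Qed.
Lemma Re_realM (a : R) (x : C) : Re (a%:C * x) = a * Re x.
Proof. by rewrite ReM /= mul0r subr0. Qed.
Lemma Im_realM (a : R) (x : C) : Im (a%:C * x) = a * Im x.
Proof. by rewrite ImM /= mul0r addr0. Qed.
Lemma Re_conj (x : C) : Re (conjc x) = Re x. Proof. by case: x. Qed.
Lemma Im_conj (x : C) : Im (conjc x) = - Im x. Proof. by case: x. Qed.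

Lemma Re_sum (I : Type) (r : seq I) (P : pred I) (F : I -> C) :
  Re (\sum_(i <- r | P i) F i) = \sum_(i <- r | P i) Re (F i).
Proof. by apply: (big_morph Re) => //; exact: ReD. Qed.
Lemma Im_sum (I : Type) (r : seq I) (P : pred I) (F : I -> C) :
  Im (\sum_(i <- r | P i) F i) = \sum_(i <- r | P i) Im (F i).
Proof. by apply: (big_morph Im) => //; exact: ImD. Qed.

Lemma adjE m n (A : 'M[C]_(m, n)) i j : adj A i j = conjc (A j i).
Proof. by rewrite /adj !mxE. Qed.

Lemma adjK m n (A : 'M[C]_(m, n)) : adj (adj A) = A.
Proof. by apply/matrixP => i j; rewrite !adjE conjcK. Qed.

Lemma adjM m n p (A : 'M[C]_(m, n)) (B : 'M[C]_(n, p)) :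
  adj (A *m B) = adj B *m adj A.
Proof. by rewrite /adj trmx_mul map_mxM. Qed.

Lemma adjD m n (A B : 'M[C]_(m, n)) : adj (A + B) = adj A + adj B.
Proof. by apply/matrixP => i j; rewrite /adj !mxE rmorphD. Qed.

Lemma adjN m n (A : 'M[C]_(m, n)) : adj (- A) = - adj A.
Proof. by apply/matrixP => i j; rewrite /adj !mxE rmorphN. Qed.

Lemma adjB m n (A B : 'M[C]_(m, n)) : adj (A - B) = adj A - adj B.
Proof. by rewrite adjD adjN. Qed.

Lemma adjZ m n (a : R) (A : 'M[C]_(m, n)) : adj (a%:C *: A) = a%:C *: adj A.
Proof. by apply/matrixP => i j; rewrite /adj !mxE rmorphM /= oppr0. Qed.

Lemma adj1 n : adj (1%:M : 'M[C]_n) = 1%:M.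
Proof. by rewrite /adj trmx1 map_mx1. Qed.

Lemma adj_sum m n (I : Type) (r : seq I) (P : pred I) (F : I -> 'M[C]_(m, n)) :
  adj (\sum_(i <- r | P i) F i) = \sum_(i <- r | P i) adj (F i).
Proof.
apply: (big_morph (@adj R m n)); first exact: adjD.
by apply/matrixP => i j; rewrite adjE !mxE conjc0.
Qed.

Lemma rtrD d (A B : 'M[C]_d) : rtr (A + B) = rtr A + rtr B.
Proof. by rewrite /rtr mxtraceD ReD. Qed.
Lemma rtrN d (A : 'M[C]_d) : rtr (- A) = - rtr A.
Proof. by rewrite /rtr raddfN /=; case: (\tr A). Qed.
Lemma rtrB d (A B : 'M[C]_d) : rtr (A - B) = rtr A - rtr B.
Proof. by rewrite rtrD rtrN. Qed.
Lemma rtrZ d (a : R) (A : 'M[C]_d) : rtr (a%:C *: A) = a * rtr A.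
Proof. by rewrite /rtr mxtraceZ Re_realM. Qed.
Lemma rtr0 d : rtr (0 : 'M[C]_d) = 0.
Proof. by rewrite /rtr raddf0. Qed.
Lemma rtr_sum d (I : Type) (r : seq I) (P : pred I) (F : I -> 'M[C]_d) :
  rtr (\sum_(i <- r | P i) F i) = \sum_(i <- r | P i) rtr (F i).
Proof. by apply: (big_morph (@rtr d)); [exact: rtrD | exact: rtr0]. Qed.
Lemma rtrC m n (A : 'M[C]_(m, n)) (B : 'M[C]_(n, m)) : rtr (A *m B) = rtr (B *m A).
Proof. by rewrite /rtr mxtrace_mulC. Qed.

Lemma rtr_hsip m n (A B : 'M[C]_(m, n)) : rtr (adj A *m B) = hsip A B.
Proof.
rewrite /rtr /hsip exchange_big /mxtrace Re_sum; apply: eq_bigr => i _ /=.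
rewrite mxE Re_sum; apply: eq_bigr => j _.
by rewrite adjE ReM Re_conj Im_conj mulNr opprK.
Qed.

Lemma hsip_ge0 m n (A : 'M[C]_(m, n)) : 0 <= hsip A A.
Proof. by do 2!(apply: sumr_ge0 => ? _); rewrite addr_ge0 // -expr2 sqr_ge0. Qed.

(** Cauchy-Schwarz in weighted arithmetic-mean form, entrywise from [(k x - y)^2 >= 0]. The free
    weight [k] replaces square roots and is tuned at each use. *)
Lemma rtr_mul_le m n (A : 'M[C]_(m, n)) (B : 'M[C]_(n, m)) (k : R) : 0 < k ->
  rtr (A *m B) <= (k * rtr (A *m adj A) + rtr (adj B *m B) / k) / 2.
Proof.
move=> k0; rewrite rtr_hsip.
have -> : rtr (A *m B) = hsip (adj A) B by rewrite -rtr_hsip adjK.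
have -> : rtr (A *m adj A) = hsip (adj A) (adj A) by rewrite -rtr_hsip adjK.
rewrite /hsip mulr_sumr mulr_suml -big_split mulr_suml; apply: ler_sum => i _.
rewrite mulr_sumr mulr_suml -big_split mulr_suml; apply: ler_sum => j _ /=.
set a := Re _; set b := Re _; set c := Im _; set e := Im _.
have h (x y : R) : x * y <= (k * x ^+ 2 + y ^+ 2 / k) / 2.
  have : 0 <= (k * x - y) ^+ 2 / k by rewrite divr_ge0 ?sqr_ge0 // ltW.
  have -> : (k * x - y) ^+ 2 / k = k * x ^+ 2 + y ^+ 2 / k - 2 * (x * y).
    by field; rewrite gt_eqF.
  lra.
have := h a b; have := h c e; rewrite !expr2; lra.
Qed.

Lemma diag_real_adj d (w : 'I_d -> R) :
  adj (diag_mx (\row_a (w a)%:C) : 'M[C]_d) = diag_mx (\row_a (w a)%:C).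
Proof.
apply/matrixP => i j; rewrite adjE !mxE eq_sym.
by case: eqP => [->|_]; rewrite ?mulr1n ?mulr0n /= oppr0.
Qed.

Lemma udu_adj d (U : 'M[C]_d) (w : 'I_d -> R) : adj (udu U w) = udu U w.
Proof. by rewrite /udu !adjM adjK diag_real_adj mulmxA. Qed.

Lemma udu_mul d (U : 'M[C]_d) (w v : 'I_d -> R) : U *m adj U = 1%:M ->
  udu U w *m udu U v = udu U (fun a => w a * v a).
Proof.
move=> /mulmx1C hU; rewrite /udu !mulmxA -(mulmxA (U *m _)) hU mulmx1.
rewrite -(mulmxA U) mulmx_diag; congr (_ *m diag_mx _ *m _).
by apply/rowP => a; rewrite !mxE -rmorphM.
Qed.

Lemma udu_add d (U : 'M[C]_d) (w v : 'I_d -> R) :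
  udu U w + udu U v = udu U (fun a => w a + v a).
Proof.
rewrite /udu -mulmxDl -mulmxDr -raddfD; congr (_ *m diag_mx _ *m _).
by apply/rowP => a; rewrite !mxE -rmorphD.
Qed.

Lemma udu_opp d (U : 'M[C]_d) (w : 'I_d -> R) :
  - udu U w = udu U (fun a => - w a).
Proof.
rewrite /udu -mulNmx -mulmxN -raddfN; congr (_ *m diag_mx _ *m _).
by apply/rowP => a; rewrite !mxE -rmorphN.
Qed.

Lemma udu1 d (U : 'M[C]_d) : U *m adj U = 1%:M -> udu U (fun=> 1) = 1%:M.
Proof.
move=> hU; rewrite /udu -[RHS]hU; congr (_ *m _).
rewrite (_ : (\row_a _) = const_mx 1) ?diag_const_mx ?mulmx1 //.
by apply/rowP => a; rewrite !mxE.
Qed.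

Lemma eq_udu d (U : 'M[C]_d) (w v : 'I_d -> R) : w =1 v -> udu U w = udu U v.
Proof. by move=> e; congr (udu U _); apply: funext. Qed.

Lemma rtr_mul_udu d (F U : 'M[C]_d) (w : 'I_d -> R) :
  rtr (F *m udu U w) = \sum_a w a * Re ((adj U *m F *m U) a a).
Proof.
rewrite /udu mulmxA rtrC !mulmxA /rtr /mxtrace Re_sum; apply: eq_bigr => a _.
by rewrite mul_mx_diag !mxE mulrC Re_realM.
Qed.

Lemma rtr_udu d (U : 'M[C]_d) (w : 'I_d -> R) : U *m adj U = 1%:M ->
  rtr (udu U w) = \sum_a w a.
Proof.
move=> hU; rewrite -[udu U w]mul1mx rtr_mul_udu; apply: eq_bigr => a _.
by rewrite mulmx1 (mulmx1C hU) mxE eqxx mulr1.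
Qed.

Lemma unitary_diag_le d (V : 'M[C]_d) a : V *m adj V = 1%:M -> `|Re (V a a)| <= 1.
Proof.
move=> hV; have /(congr1 Re) : (V *m adj V) a a = 1 by rewrite hV mxE eqxx.
rewrite mxE Re_sum (bigD1 a) //= adjE ReM Re_conj Im_conj mulrN opprK => h.
have h2 : 0 <= \sum_(i < d | i != a) Re (V a i * adj V i a).
  apply: sumr_ge0 => i _; rewrite adjE ReM Re_conj Im_conj mulrN opprK.
  by rewrite addr_ge0 // -expr2 sqr_ge0.
rewrite -(@ler_pXn2r _ 2) ?nnegrE // expr1n real_normK ?num_real //.
have : 0 <= Im (V a a) * Im (V a a) by rewrite -expr2 sqr_ge0.
rewrite expr2; move: h h2; set x := \sum_(_ < _ | _) _; lra.
Qed.

Lemma hunitary_diag_le d (U S : 'M[C]_d) a : U *m adj U = 1%:M ->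
  S *m adj S = 1%:M -> `|Re ((adj U *m S *m U) a a)| <= 1.
Proof.
move=> hU hS; apply: unitary_diag_le.
rewrite !adjM adjK !mulmxA -(mulmxA _ U) hU mulmx1 -(mulmxA _ S) hS mulmx1.
exact: mulmx1C.
Qed.

Definition proj d (P : 'M[C]_d) := adj P = P /\ P *m P = P.

Lemma projC d (P : 'M[C]_d) : proj P -> proj (1%:M - P).
Proof.
move=> [h1 h2]; split; first by rewrite adjB adj1 h1.
by rewrite mulmxBl !mulmxBr mul1mx mulmx1 h2 mul1mx subrr subr0.
Qed.

Lemma proj_refl d (P : 'M[C]_d) : proj P -> let S := 1%:M - (P + P) in
  adj S = S /\ S *m S = 1%:M.
Proof.
move=> [h1 h2] S; rewrite /S; split; first by rewrite adjB adj1 adjD h1.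
rewrite mulmxBl !mulmxBr mul1mx mulmx1 mul1mx mulmxDl mulmxDr h2.
by rewrite [in X in _ - X]opprD addrA subrr sub0r opprK subrK.
Qed.

(** The reflection [1 - 2P] is a hermitian unitary, so its diagonal entries [1 - 2z] in the basis
    [U] lie in [[-1, 1]]. *)
Lemma proj_diag d (U P : 'M[C]_d) a : U *m adj U = 1%:M -> proj P ->
  0 <= Re ((adj U *m P *m U) a a) <= 1.
Proof.
move=> hU hP; have [S1 S2] := proj_refl hP.
have := @hunitary_diag_le d U (1%:M - (P + P)) a hU; rewrite S1 S2 => /(_ erefl).
rewrite mulmxBr mulmxBl mulmx1 (mulmx1C hU) mulmxDr mulmxDl.
rewrite mxE mxE eqxx mxE [X in - X]mxE opprD ReD ReD /=.
set z := (adj U *m P *m U) a a.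
have -> : Re (- z) = - Re z by case: z.
rewrite ler_norml => /andP[]; lra.
Qed.

Lemma proj_udu d (U : 'M[C]_d) (P : pred 'I_d) : U *m adj U = 1%:M ->
  proj (udu U (fun a => (P a)%:R)).
Proof.
move=> hU; split; first exact: udu_adj.
by rewrite udu_mul //; apply: eq_udu => a; case: (P a); rewrite ?mulr1 ?mulr0.
Qed.

Lemma rtr_proj_udu_le d (U P : 'M[C]_d) (w : 'I_d -> R) :
  U *m adj U = 1%:M -> proj P -> (forall a, 0 <= w a) ->
  0 <= rtr (P *m udu U w) <= \sum_a w a.
Proof.
move=> hU hP w0; rewrite rtr_mul_udu; apply/andP; split.
  by apply: sumr_ge0 => a _; rewrite mulr_ge0 //; case/andP: (proj_diag a hU hP).
apply: ler_sum => a _; rewrite ler_piMr //.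
by case/andP: (proj_diag a hU hP).
Qed.

Lemma rtr_hunitary_udu_le d (U S : 'M[C]_d) (w : 'I_d -> R) :
  U *m adj U = 1%:M -> S *m adj S = 1%:M -> (forall a, 0 <= w a) ->
  `|rtr (udu U w *m S)| <= \sum_a w a.
Proof.
move=> hU hS w0; rewrite rtrC rtr_mul_udu; apply: (le_trans (ler_norm_sum _ _ _)).
apply: ler_sum => a _; rewrite normrM ger0_norm // ler_piMr //.
exact: hunitary_diag_le.
Qed.

Lemma herm_spec d (A : 'M[C]_d) : adj A = A ->
  exists (U : 'M[C]_d) (w : 'I_d -> R), U *m adj U = 1%:M /\ A = udu U w.
Proof.
move=> hA; have hA' : A \is hermsymmx.
  by apply/is_hermitianmxP; rewrite expr0 scale1r -[LHS]hA.
have hn := hermitian_normalmx hA'.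
have /orthomx_spectralP := hn; set P := spectralmx A; set s := spectral_diag A.
have hP : P \is unitarymx := spectral_unitarymx A.
rewrite (invmx_unitary hP) => eA.
exists (adj P), (fun a => Re (s 0 a)); split.
  by rewrite adjK; apply: mulmx1C; exact: (unitarymxP hP).
rewrite /udu adjK {1}eA; congr (_ *m diag_mx _ *m _).
apply/rowP => a; rewrite mxE.
have /mxOverP/(_ 0 a) := hermitian_spectral_diag_real hA'.
by move/RRe_real => ->.
Qed.

Lemma spec_decE d (A U : 'M[C]_d) (l : 'rV[R]_d) :
  spec_dec A U l <-> U *m adj U = 1%:M /\ A = udu U (fun a => l 0 a).
Proof.
rewrite /spec_dec /udu.
by have -> : map_mx (fun r => r%:C) l = \row_a (l 0 a)%:C by apply/rowP => a; rewrite !mxE.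
Qed.

(* Two diagonalisations are intertwined by [adj V *m U], which only couples
   equal eigenvalues; hence [hfun] does not depend on the chosen one. *)
Lemma hfun_udu d (f : R -> R) (U : 'M[C]_d) (w : 'I_d -> R) :
  U *m adj U = 1%:M -> hfun f (udu U w) = udu U (fun a => f (w a)).
Proof.
move=> hU; rewrite /hfun; case: pselect => [h|]; last first.
  move=> []; exists (U, \row_a w a); apply/spec_decE; split => //=.
  by apply: eq_udu => a; rewrite mxE.
case: (cid h) => -[V l] /= /spec_decE /= [hV e].
have -> : map_mx (fun r => (f r)%:C) l = \row_a (f (l 0 a))%:C.
  by apply/rowP => a; rewrite !mxE.
have {}e : (adj V *m U) *m diag_mx (\row_a (w a)%:C) =
    diag_mx (\row_a (l 0 a)%:C) *m (adj V *m U).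
  move: e => /(congr1 (fun B => adj V *m B *m U)); rewrite /udu !mulmxA.
  rewrite -(mulmxA _ (adj U)) (mulmx1C hU) mulmx1 (mulmx1C hV) mul1mx.
  by rewrite -!mulmxA.
have e2 : (adj V *m U) *m diag_mx (\row_a (f (w a))%:C) =
    diag_mx (\row_a (f (l 0 a))%:C) *m (adj V *m U).
  apply/matrixP => i j; move/matrixP/(_ i j): e.
  rewrite !mul_mx_diag !mul_diag_mx !mxE; set m := \sum_ _ _.
  have [->|m0] := eqVneq m 0; first by rewrite !mul0r !mulr0.
  by rewrite mulrC => /(mulIf m0)[->]; rewrite mulrC.
rewrite /udu; move/(congr1 (fun B => V *m B *m adj U)): e2.
rewrite !mulmxA hV mul1mx => ->.
by rewrite -!mulmxA hU mulmx1.
Qed.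

Lemma trnorm_udu d (U : 'M[C]_d) (w : 'I_d -> R) : U *m adj U = 1%:M ->
  trnorm (udu U w) = \sum_a `|w a|.
Proof.
move=> hU; rewrite /trnorm udu_adj udu_mul // hfun_udu // -/(rtr _) rtr_udu //.
by apply: eq_bigr => a _; rewrite -expr2 sqrtr_sqr.
Qed.

Lemma trnorm_ge0 d (A : 'M[C]_d) : adj A = A -> 0 <= trnorm A.
Proof.
by move=> /herm_spec[U [w [hU ->]]]; rewrite trnorm_udu //; apply: sumr_ge0.
Qed.

(** [S] is the sign of [A], set to 1 on the kernel so that it stays an involution. *)
Lemma trnorm_attained d (A : 'M[C]_d) : adj A = A ->
  exists S, [/\ adj S = S, S *m S = 1%:M & trnorm A = rtr (A *m S)].
Proof.
move=> /herm_spec[U [w [hU ->]]].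
exists (udu U (fun a => if 0 <= w a then 1 else -1)); split.
- exact: udu_adj.
- rewrite udu_mul // -(udu1 hU); apply: eq_udu => a.
  by case: ifP => _; rewrite ?mulrNN mulr1.
- rewrite udu_mul // rtr_udu // trnorm_udu //; apply: eq_bigr => a _.
  case: ifP => [/ger0_norm->|]; first by rewrite mulr1.
  by move/negbT; rewrite -ltNge => /ltr0_norm ->; rewrite mulrN1.
Qed.

(** Helstrom's bound: pairing [A] with the reflection [1 - 2P] costs at most the trace norm, and for
    traceless [A] this pairing is [-2 tr(P A)]. *)
Lemma rtr_proj_le_trnorm d (A P : 'M[C]_d) : adj A = A -> rtr A = 0 -> proj P ->
  rtr (P *m A) <= trnorm A / 2.
Proof.
move=> /herm_spec[U [w [hU ->]]] t0 hP; rewrite trnorm_udu //.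
have [S1 S2] := proj_refl hP.
have : - rtr ((1%:M - (P + P)) *m udu U w) <= \sum_a `|w a|.
  rewrite rtr_mul_udu -sumrN; apply: ler_sum => a _.
  apply: le_trans (ler_norm _) _; rewrite normrN normrM ler_piMr //.
  by apply: hunitary_diag_le; rewrite // S1.
rewrite mulmxBl mulmxDl mul1mx rtrB t0 rtrD; lra.
Qed.

End Matrices.

(** * Second moments, Chernoff bounds and empirical laws of independent samples *)

Section Probability.
Variable R : realType.

Lemma prod_if_eq (I : finType) (F : I -> R) (i : I) :
  \prod_k (if k == i then F k else 1) = F i.
Proof. by rewrite -big_mkcond big_pred1_eq. Qed.

Lemma sum_prod_dist (I A : finType) (v : I -> A -> R) :
  (forall i, \sum_a v i a = 1) ->
  \sum_(f : {ffun I -> A}) \prod_i v i (f i) = 1.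
Proof. by move=> h; rewrite -bigA_distr_bigA big1. Qed.

(** Independence factorises the expectation: off the diagonal a centred factor vanishes, and
    coordinates other than [i] and [j] integrate to 1. *)
Lemma prod_dist_cov (I A : finType) (v Z : I -> A -> R) (i j : I) :
  (forall i, \sum_a v i a = 1) -> (forall i, \sum_a v i a * Z i a = 0) ->
  \sum_(f : {ffun I -> A}) (\prod_k v k (f k)) * (Z i (f i) * Z j (f j)) =
  (if i == j then \sum_a v i a * Z i a ^+ 2 else 0).
Proof.
move=> h1 h0.
transitivity (\sum_(f : {ffun I -> A}) \prod_k
   (v k (f k) * ((if k == i then Z k (f k) else 1) *
                 (if k == j then Z k (f k) else 1)))).
  apply: eq_bigr => f _; rewrite !big_split /=.
  by rewrite (prod_if_eq (fun k => Z k (f k))) (prod_if_eq (fun k => Z k (f k))).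
rewrite -(bigA_distr_bigA (fun k a => v k a * ((if k == i then Z k a else 1) *
                 (if k == j then Z k a else 1)))) /= (bigD1 i) //= eqxx.
have [->|ij] := eqVneq i j.
  rewrite [X in _ * X]big1 ?mulr1; first by apply: eq_bigr => a _; rewrite expr2.
  move=> k /negbTE kj; rewrite kj -[RHS](h1 k).
  by apply: eq_bigr => a _; rewrite !mulr1.
by under eq_bigr do rewrite mulr1; rewrite h0 mul0r.
Qed.

Lemma prod_dist_var (I A : finType) (v Z : I -> A -> R) :
  (forall i a, 0 <= v i a) -> (forall i, \sum_a v i a = 1) ->
  \sum_(f : {ffun I -> A}) (\prod_i v i (f i)) *
     (\sum_i Z i (f i) - \sum_i \sum_a v i a * Z i a) ^+ 2 <=
  \sum_i \sum_a v i a * Z i a ^+ 2.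
Proof.
move=> v0 h1; pose m i := \sum_a v i a * Z i a; pose Y i a := Z i a - m i.
have hY i : \sum_a v i a * Y i a = 0.
  rewrite /Y; under eq_bigr do rewrite mulrBr.
  by rewrite sumrB -mulr_suml h1 mul1r subrr.
rewrite (_ : \sum_(f : {ffun I -> A}) _ = \sum_i \sum_a v i a * Y i a ^+ 2).
  apply: ler_sum => i _; rewrite -subr_ge0 -sumrB.
  have -> : \sum_a (v i a * Z i a ^+ 2 - v i a * Y i a ^+ 2) = m i ^+ 2.
    rewrite (eq_bigr (fun a => m i * (v i a * Z i a) *+ 2 - v i a * m i ^+ 2)).
      rewrite sumrB -mulr_suml h1 sumrMnl -mulr_sumr -/(m i) mul1r; ring.
    by move=> a _; rewrite /Y; ring.
  exact: sqr_ge0.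
transitivity (\sum_(f : {ffun I -> A}) \sum_i \sum_j
   (\prod_k v k (f k)) * (Y i (f i) * Y j (f j))).
  apply: eq_bigr => f _; rewrite -sumrB expr2 big_distrlr mulr_sumr.
  by apply: eq_bigr => i _; rewrite mulr_sumr.
rewrite exchange_big; apply: eq_bigr => i _ /=.
rewrite exchange_big (bigD1 i) //= (prod_dist_cov _ _ h1 hY) eqxx.
rewrite [X in _ + X]big1 ?addr0 // => j ji.
by rewrite (prod_dist_cov _ _ h1 hY) eq_sym (negbTE ji).
Qed.

Lemma chebyshev_prod (I A : finType) (v Z : I -> A -> R) (D : R) : 0 < D ->
  (forall i a, 0 <= v i a) -> (forall i, \sum_a v i a = 1) ->
  \sum_(f : {ffun I -> A}) (\prod_i v i (f i)) *
     (D <= `|\sum_i Z i (f i) - \sum_i \sum_a v i a * Z i a|)%R%:R <=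
  (\sum_i \sum_a v i a * Z i a ^+ 2) / D ^+ 2.
Proof.
move=> D0 v0 h1; rewrite ler_pdivlMr ?exprn_gt0 //.
apply: le_trans (prod_dist_var Z v0 h1); rewrite mulr_suml; apply: ler_sum => f _.
rewrite -mulrA ler_wpM2l ?prodr_ge0 //.
set x := _ - _; case: (leP D `|x|) => h; last by rewrite mul0r sqr_ge0.
by rewrite mul1r -[leRHS]real_normK ?num_real // ler_pXn2r ?nnegrE // ltW.
Qed.

(** Convertible to the scalar function inside [mlog], value 0 at 0 included, which lets [hfun_udu]
    evaluate relative entropies. *)
Definition lg (t : R) : R := if t == 0 then 0 else log2 t.

Lemma ln2_gt0 : 0 < ln 2 :> R. Proof. by rewrite ln_gt0 // ltr1n. Qed.

Lemma pow2_gt0 (x : R) : 0 < 2 `^ x. Proof. by rewrite powR_gt0. Qed.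
Lemma pow2_ge0 (x : R) : 0 <= 2 `^ x. Proof. exact/ltW/pow2_gt0. Qed.

Lemma pow2D (x y : R) : 2 `^ (x + y) = 2 `^ x * 2 `^ y.
Proof. by rewrite powRD // pnatr_eq0 implybT. Qed.

Lemma pow2N (x : R) : 2 `^ (- x) = (2 `^ x)^-1.
Proof. by rewrite powRN. Qed.

Lemma pow2E (x : R) : 2 `^ x = expR (x * ln 2).
Proof. by rewrite /powR pnatr_eq0. Qed.

Lemma ltr_pow2 (x y : R) : (2 `^ x < 2 `^ y) = (x < y).
Proof. by rewrite !pow2E ltr_expR ltr_pM2r // ln2_gt0. Qed.

Lemma ler_pow2 (x y : R) : (2 `^ x <= 2 `^ y) = (x <= y).
Proof. by rewrite !pow2E ler_expR ler_pM2r // ln2_gt0. Qed.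

Lemma pow2_log2 (x : R) : 0 < x -> 2 `^ log2 x = x.
Proof.
by move=> x0; rewrite pow2E /log2 divfK ?gt_eqF ?ln2_gt0 // lnK.
Qed.

Lemma prod_pow2_lg (I : finType) (F : I -> R) : (forall i, 0 < F i) ->
  \prod_i F i = 2 `^ (\sum_i lg (F i)).
Proof.
move=> h; elim/big_rec2: _ => [|i x y _ ->]; first by rewrite powRr0.
by rewrite pow2D /lg gt_eqF // pow2_log2.
Qed.

(** For letters drawn from [v], the logarithm of the product of [w]-weights is a sum of independent
    terms, to which Chebyshev applies. Taking [w] different from [v] covers a state measured in the
    eigenbasis of another one. *)
Lemma prod_typical (I A : finType) (v w : I -> A -> R) (D : R) : 0 < D ->
  (forall i a, 0 <= v i a) -> (forall i, \sum_a v i a = 1) ->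
  (forall i a, 0 <= w i a) -> (forall i a, w i a = 0 -> v i a = 0) ->
  let m := \sum_i \sum_a v i a * lg (w i a) in
  let K := \sum_i \sum_a v i a * lg (w i a) ^+ 2 in
  \sum_(f : {ffun I -> A}) (\prod_i v i (f i)) *
     (2 `^ (m + D) < \prod_i w i (f i))%R%:R <= K / D ^+ 2 /\
  \sum_(f : {ffun I -> A}) (\prod_i v i (f i)) *
     (\prod_i w i (f i) < 2 `^ (m - D))%R%:R <= K / D ^+ 2.
Proof.
move=> D0 v0 v1 w0 wv m K.
have key (b : {ffun I -> A} -> bool) :
    (forall f : {ffun I -> A}, (forall i, 0 < w i (f i)) -> b f ->
       D <= `|\sum_i lg (w i (f i)) - m|) ->
    \sum_(f : {ffun I -> A}) (\prod_i v i (f i)) * (b f)%:R <= K / D ^+ 2.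
  move=> hb; apply: le_trans (chebyshev_prod (fun i a => lg (w i a)) D0 v0 v1).
  apply: ler_sum => f _; have [hf|] := pselect (forall i, 0 < w i (f i)).
    rewrite ler_wpM2l ?prodr_ge0 // ler_nat.
    by case E: (b f) => //; rewrite hb.
  (* A string containing a letter of zero [w]-weight has zero probability, so the logarithm of zero
     never matters. *)
  move=> /existsNP[i /negP]; rewrite -leNgt => hi.
  have /wv vi : w i (f i) = 0 by apply/eqP; rewrite eq_le hi w0.
  by rewrite (bigD1 i) //= vi !mul0r.
split; apply: key => f hf; rewrite (prod_pow2_lg hf) ltr_pow2 => h.
  by apply: le_trans (ler_norm _); lra.
by rewrite distrC; apply: le_trans (ler_norm _); lra.
Qed.

Definition lgsq_max : R := 4 / ln 2 ^+ 2.

Lemma lgsq_max_ge0 : 0 <= lgsq_max. Proof. by rewrite divr_ge0 // sqr_ge0. Qed.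

(** With [u = sqrt s], the inequality [ln y <= y - 1] at [y = 1/u] gives [- u ln u <= 1], and
    [s (ln s)^2] is four times the square of [u ln u]. *)
Lemma mul_lg_sqr_le (s : R) : 0 <= s <= 1 -> s * lg s ^+ 2 <= lgsq_max.
Proof.
move=> /andP[]; rewrite le_eqVlt => /predU1P[<-|s0] s1.
  by rewrite mul0r lgsq_max_ge0.
rewrite /lg gt_eqF // /log2 expr_div_n mulrA /lgsq_max ler_pM2r ?invr_gt0 ?exprn_gt0 ?ln2_gt0 //.
pose u := Num.sqrt s; have u0 : 0 < u by rewrite sqrtr_gt0.
have us : s = u ^+ 2 by rewrite sqr_sqrtr // ltW.
have u1 : u <= 1 by rewrite -(@ler_pXn2r _ 2) ?nnegrE ?(ltW u0) // -us expr1n.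
have lu : ln u <= 0 by rewrite ln_le0.
have : - (u * ln u) <= 1.
  have : ln u^-1 <= u^-1 - 1.
    have := @le_ln1Dx R (u^-1 - 1); rewrite addrCA subrr addr0; apply.
    by rewrite ltrBrDl subrr invr_gt0.
  rewrite lnV ?posrE // => h; rewrite -mulrN.
  have : u * (- ln u) <= u * (u^-1 - 1) by rewrite ler_pM2l.
  rewrite mulrBr mulfV ?gt_eqF // mulr1; lra.
have : 0 <= - (u * ln u) by rewrite -mulrN mulr_ge0 ?oppr_ge0 // ltW.
move=> h1 h2; rewrite us lnXn //.
have -> : u ^+ 2 * (ln u *+ 2) ^+ 2 = 4 * (- (u * ln u)) ^+ 2 by ring.
have : (- (u * ln u)) ^+ 2 <= 1 by rewrite expr_le1.
lra.
Qed.

(** Markov's inequality for the exponential of the sum divided by [eta]. On [[0, 2/eta]],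
    [exp y <= 1 + y exp(2/eta)], so each factor has mean at most [1 + 1/2 <= exp(1/2)], against the
    threshold [exp N]. *)
Lemma chernoff_prod (T : finType) (N : nat) (p a : T -> R) (mu eta : R) :
  (forall x, 0 <= p x) -> \sum_x p x = 1 -> (forall x, 0 <= a x <= 2) ->
  \sum_x p x * a x <= mu -> 0 < eta -> mu * expR (2 / eta) <= eta / 2 ->
  \sum_(f : {ffun 'I_N -> T}) (\prod_i p (f i)) *
     (N%:R * eta <= \sum_i a (f i))%R%:R <= expR (- (N%:R / 2)).
Proof.
move=> p0 p1 a02 hmu eta0 hm.
have hx x : expR (a x / eta) <= 1 + a x / eta * expR (2 / eta).
  have /andP[ax0 ax2] := a02 x; set y := a x / eta.
  have y0 : 0 <= y by rewrite divr_ge0 // ltW.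
  have : expR y * (1 - y) <= 1.
    have := expR_ge1Dx (- y); rewrite expRN => h.
    have : expR y * (1 + - y) <= expR y * (expR y)^-1 by rewrite ler_pM2l ?expR_gt0.
    by rewrite mulfV // gt_eqF // expR_gt0.
  have : y * expR y <= y * expR (2 / eta).
    by rewrite ler_wpM2l // ler_expR ler_pM2r // invr_gt0.
  lra.
have hs : \sum_x p x * expR (a x / eta) <= expR (1 / 2).
  apply: (@le_trans _ _ (1 + 1 / 2)); last exact: expR_ge1Dx.
  apply: (@le_trans _ _ (\sum_x (p x + p x * a x * (expR (2 / eta) / eta)))).
    apply: ler_sum => x _; have : p x * expR (a x / eta) <= p x * (1 + a x / eta * expR (2 / eta)).
      by rewrite ler_wpM2l.
    by move=> h; apply: (le_trans h); rewrite le_eqVlt; apply/orP; left; apply/eqP; ring.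
  rewrite big_split /= p1 -mulr_suml lerD2l.
  apply: (@le_trans _ _ (mu * (expR (2 / eta) / eta))).
    by rewrite ler_wpM2r // divr_ge0 ?expR_ge0 // ltW.
  by rewrite mulrA ler_pdivrMr //; lra.
apply: (@le_trans _ _ (\sum_(f : {ffun 'I_N -> T})
    (\prod_i (p (f i) * expR (a (f i) / eta))) * expR (- N%:R))).
  apply: ler_sum => f _; rewrite big_split /= -mulrA ler_wpM2l ?prodr_ge0 //.
  rewrite -expR_sum -expRD -mulr_suml; case: (leP (N%:R * eta)) => h; last exact: expR_ge0.
  rewrite -[leLHS]expR0 ler_expR subr_ge0 ler_pdivlMr //.
rewrite -mulr_suml -(bigA_distr_bigA (fun i x => p x * expR (a x / eta))) /=.
rewrite big_const card_ord iter_mulr_1.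
apply: (@le_trans _ _ (expR (1 / 2) ^+ N * expR (- N%:R))).
  rewrite ler_wpM2r ?expR_ge0 // lerXn2r ?nnegrE ?expR_ge0 //.
  by apply: sumr_ge0 => x _; rewrite mulr_ge0 // expR_ge0.
rewrite -expRM_natr -expRD ler_expR; lra.
Qed.

(** Serves both as the law of a random codebook of size [M] and, for [T = X], as the type of a
    word. *)
Definition emp (T : finType) (M : nat) (f : {ffun 'I_M -> T}) : {ffun T -> R} :=
  [ffun x => (\sum_i (f i == x)%:R) / M%:R].

Lemma emp_sum (T : finType) (M : nat) (f : {ffun 'I_M -> T}) (V : lmodType R)
    (z : T -> V) :
  \sum_x emp f x *: z x = M%:R^-1 *: \sum_i z (f i).
Proof.
rewrite scaler_sumr.
under eq_bigr => x _ do rewrite ffunE mulrC -scalerA scaler_suml scaler_sumr.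
rewrite exchange_big; apply: eq_bigr => i _ /=.
rewrite -scaler_sumr; congr (_ *: _).
rewrite (bigD1 (f i)) //= eqxx scale1r big1 ?addr0 // => x /negbTE.
by rewrite eq_sym => ->; rewrite scale0r.
Qed.

Lemma emp_sumr (T : finType) (M : nat) (f : {ffun 'I_M -> T}) (z : T -> R) :
  \sum_x emp f x * z x = (\sum_i z (f i)) / M%:R.
Proof. by rewrite [RHS]mulrC -[RHS](emp_sum f (z : T -> R^o)). Qed.

Lemma emp_probM (T : finType) (M : nat) (f : {ffun 'I_M -> T}) : (0 < M)%N ->
  probM M (emp f).
Proof.
move=> M0; have Mn : M%:R != 0 :> R by rewrite pnatr_eq0 -lt0n.
split; first split.
- by move=> x; rewrite ffunE divr_ge0 // sumr_ge0.
- have := emp_sumr f (fun=> 1); under eq_bigr do rewrite mulr1.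
  by move=> ->; rewrite sumr_const card_ord mulfV.
- move=> x; rewrite ffunE mulrC divfK //.
  by apply: rpred_sum => i _; case: eqP => _; rewrite ?rpred1 ?rpred0.
Qed.

(** List each [x] exactly [M q(x)] times; the list has length [M]. Hence there are at most
    [#|T| ^ M] such laws, which the union bound uses. *)
Lemma probM_emp (T : finType) (M : nat) (q : {ffun T -> R}) : (0 < M)%N ->
  probM M q -> exists f : {ffun 'I_M -> T}, q = emp f.
Proof.
move=> M0 [[q0 q1] qM]; have Mn : M%:R != 0 :> R by rewrite pnatr_eq0 -lt0n.
have /choice[k hk] x : exists k : nat, M%:R * q x = k%:R.
  have := qM x; rewrite intrEge0 ?mulr_ge0 // => /natrP[k ->]; by exists k.
pose s := flatten [seq nseq (k x) x | x <- enum T].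
have cs x : count_mem x s = k x.
  rewrite /s count_flatten sumnE -map_comp big_map big_enum /= (bigD1 x) //=.
  rewrite count_nseq /= eqxx mul1n big1 ?addn0 // => y /negbTE yx.
  by rewrite count_nseq /= yx mul0n.
have ss : size s = M.
  apply/eqP; rewrite -(eqr_nat R); apply/eqP.
  transitivity (\sum_x M%:R * q x); last by rewrite -mulr_sumr q1 mulr1.
  rewrite /s size_flatten sumnE big_map big_map big_enum /= natr_sum.
  by apply: eq_bigr => x _; rewrite size_nseq hk.
have [x0 _] : exists x0 : T, True.
  case: (pickP T) => [x0 _|h]; first by exists x0.
  by move: q1; rewrite big_pred0 // => /esym/eqP; rewrite oner_eq0.
exists [ffun i : 'I_M => nth x0 s i]; apply/ffunP => x; rewrite ffunE.
apply: (mulfI Mn); rewrite hk mulrC divfK // -cs -sumn_count sumnE big_map.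
rewrite (big_nth x0) ss big_mkord natr_sum; apply: eq_bigr => i _.
by rewrite ffunE.
Qed.

Lemma emp_var (T : finType) (M : nat) (p : T -> R) (z : T -> R) : (0 < M)%N ->
  (forall x, 0 <= p x) -> \sum_x p x = 1 ->
  \sum_(f : {ffun 'I_M -> T}) (\prod_i p (f i)) *
     (\sum_x (p x - emp f x) * z x) ^+ 2 <= (\sum_x p x * z x ^+ 2) / M%:R.
Proof.
move=> M0 p0 p1; have Mp : 0 < M%:R :> R by rewrite ltr0n.
have h := @prod_dist_var _ _ (fun _ : 'I_M => p) (fun=> z) (fun=> p0) (fun=> p1).
rewrite ler_pdivlMr // -(ler_pM2r Mp) -mulrA -expr2 mulr_suml.
apply: le_trans (le_trans h _); last first.
  by rewrite sumr_const card_ord mulr_natr.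
apply: ler_sum => f _; rewrite -mulrA -exprMn.
rewrite (_ : _ * M%:R = - (\sum_i z (f i) - \sum_(i < M) \sum_a p a * z a)) ?sqrrN //.
under eq_bigr do rewrite mulrBl.
rewrite sumrB emp_sumr mulrBl divfK ?gt_eqF // sumr_const card_ord mulr_natr.
by rewrite opprB.
Qed.

(** The term of order [k+1] in the exponential series already beats [n^k]; the threshold [D] is
    solved from that comparison. *)
Lemma poly_pow2_small (k : nat) (a e : R) : 0 < a -> 0 < e ->
  exists n0 : nat, forall n, (n0 <= n)%N -> n.+1%:R ^+ k * 2 `^ (- (n%:R * a)) <= e.
Proof.
move=> a0 e0; pose b := a * ln 2; have b0 : 0 < b by rewrite mulr_gt0 // ln2_gt0.
pose F : R := (k.+1)`!%:R; have F0 : 0 < F by rewrite ltr0n fact_gt0.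
pose D := (2 ^+ k * F) / (b ^+ k.+1 * e).
exists (Num.truncn D).+1 => n hn.
have hD : D <= n%:R.
  by apply/ltW/(lt_le_trans (truncnS_gt D)); rewrite ler_nat.
have n0 : (0 < n)%N by apply: leq_trans hn.
have nR : 0 < n%:R :> R by rewrite ltr0n.
rewrite pow2N ler_pdivrMr ?pow2_gt0 //.
apply: (@le_trans _ _ ((2 * n%:R) ^+ k)).
  rewrite lerXn2r ?nnegrE ?mulr_ge0 //.
  by rewrite -natrM ler_nat; lia.
have h : (n%:R * b) ^+ k.+1 / F <= 2 `^ (n%:R * a).
  rewrite pow2E -mulrA -/b; apply: le_trans (expR_ge1Dxn k _); first lra.
  by rewrite mulr_ge0 // ltW.
apply: (@le_trans _ _ (e * ((n%:R * b) ^+ k.+1 / F))); last by rewrite ler_pM2l.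
rewrite (exprMn k 2) (exprMn k.+1 _ b) (exprS n%:R).
have : 2 ^+ k * F <= n%:R * (b ^+ k.+1 * e).
  by rewrite -ler_pdivrMr // mulr_gt0 // exprn_gt0.
move=> h3; rewrite mulrA ler_pdivlMr // [leLHS]mulrAC.
have -> : e * (n%:R * n%:R ^+ k * b ^+ k.+1) = n%:R * (b ^+ k.+1 * e) * n%:R ^+ k by ring.
by rewrite ler_pM2r // exprn_gt0.
Qed.

Lemma div_nat_small (A b : R) : 0 < b ->
  exists n0 : nat, forall n, (n0 <= n)%N -> (0 < n)%N /\ A / n%:R <= b.
Proof.
move=> b0; exists (Num.truncn (A / b)).+1 => n hn.
have n0 : (0 < n)%N by apply: leq_trans hn.
split => //; rewrite ler_pdivrMr ?ltr0n // mulrC -ler_pdivrMr //.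
by apply/ltW/(lt_le_trans (truncnS_gt _)); rewrite ler_nat.
Qed.

Lemma nat_exp_le (k m : nat) : (k ^ m)%:R <= expR (k%:R * m%:R) :> R.
Proof.
rewrite natrX expRM_natr lerXn2r ?nnegrE ?expR_ge0 //.
by apply: le_trans (expR_ge1Dx _); rewrite lerDr.
Qed.

(** A number at least 1 is at most twice its integer part, so rounding a codebook size costs a
    factor 2. *)
Lemma truncn_pow2 (n : nat) (r : R) : 0 <= r ->
  let M := Num.truncn (2 `^ (n%:R * r)) in
  [/\ (0 < M)%N, M%:R <= 2 `^ (n%:R * r) :> R & 2 `^ (n%:R * r) <= 2 * M%:R :> R].
Proof.
move=> r0 M; have h1 : 1 <= 2 `^ (n%:R * r) :> R.
  by rewrite -[leLHS](powRr0 2) ler_pow2 mulr_ge0.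
have hM : (0 < M)%N by rewrite truncn_gt0.
split => //; first by rewrite truncn_le pow2_ge0.
have := truncnS_gt (2 `^ (n%:R * r)); rewrite -/M -natr1 => h2.
have : 1 <= M%:R :> R by rewrite ler1n.
lra.
Qed.

Lemma log2_le_pow2 (m r : R) : 0 < m -> m <= 2 `^ r -> log2 m <= r.
Proof.
by move=> m0; rewrite -{1}(pow2_log2 m0) ler_pow2.
Qed.

End Probability.

(** * Tensor powers in coordinates indexed by strings *)

Section Tensor.
Local Open Scope complex_scope.
Variables (R : realType) (d : nat).
Local Notation C := (R[i]).
Local Notation Re := (@complex.Re R).

Lemma ord0_absurd : 'I_0 -> False. Proof. by case. Qed.

(** Peels off one factor at a time with the index splitting of [tens_fam], so that entries of a
    tensor product become products of entries. *)
Fixpoint digits (n : nat) : 'I_(d ^ n) -> 'I_n -> 'I_d :=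
  match n return 'I_(d ^ n) -> 'I_n -> 'I_d with
  | 0 => fun _ k => False_rect _ (ord0_absurd k)
  | n'.+1 => fun i k =>
      let ij := mxtens_unindex (cast_ord (expnS d n') i) in
      if unlift ord0 k is Some k' then digits ij.2 k' else ij.1
  end.

Definition dec n (i : 'I_(d ^ n)) : {ffun 'I_n -> 'I_d} := [ffun k => digits i k].

Lemma tens_famE n (g : 'I_n -> 'M[C]_d) i j :
  tens_fam g i j = \prod_k g k (dec i k) (dec j k).
Proof.
rewrite (eq_bigr (fun k => g k (digits i k) (digits j k))); last first.
  by move=> k _; rewrite !ffunE.
elim: n g i j => [|n IH] g i j /=.
  rewrite castmxE big_ord0 mxE /=.
  have /= h (k : 'I_(d ^ 0)) : k = 0%N :> nat.
    by case: k => m /=; rewrite expn0; case: m.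
  by rewrite -val_eqE /= !h.
rewrite castmxE /= mxE IH big_ord_recl unlift_none /= !esymK; congr (_ * _).
by apply: eq_bigr => k _; rewrite liftK.
Qed.

Lemma dec_inj n : injective (@dec n).
Proof.
move=> i j /ffunP h.
have {}h k : digits i k = digits j k by have := h k; rewrite !ffunE.
elim: n i j h => [|n IH] i j h.
  have /= h0 (k : 'I_(d ^ 0)) : k = 0%N :> nat.
    by case: k => m /=; rewrite expn0; case: m.
  by apply: val_inj; rewrite /= !h0.
apply: (@cast_ord_inj _ _ (expnS d n)).
apply: (can_inj (@mxtens_unindexK _ _)).
have h1 := h ord0; rewrite /= unlift_none in h1.
have h2 : (mxtens_unindex (cast_ord (expnS d n) i)).2 =
          (mxtens_unindex (cast_ord (expnS d n) j)).2.
  by apply: IH => k; have := h (lift ord0 k); rewrite /= liftK.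
by apply: injective_projections; [exact: h1 | exact: h2].
Qed.

Lemma dec_bij n : bijective (@dec n).
Proof. by apply: inj_card_bij; [exact: dec_inj | rewrite card_ffun !card_ord]. Qed.

Lemma sum_dec (V : nmodType) n (F : {ffun 'I_n -> 'I_d} -> V) :
  \sum_(f : {ffun 'I_n -> 'I_d}) F f = \sum_(b : 'I_(d ^ n)) F (dec b).
Proof. by rewrite (reindex (@dec n)) //; apply: onW_bij; exact: dec_bij. Qed.

Lemma tens_mul n (A B : 'I_n -> 'M[C]_d) :
  tens_fam A *m tens_fam B = tens_fam (fun k => A k *m B k).
Proof.
apply/matrixP => i j; rewrite mxE tens_famE.
transitivity (\sum_b \prod_k (A k (dec i k) (dec b k) * B k (dec b k) (dec j k))).
  by apply: eq_bigr => b _; rewrite !tens_famE -big_split.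
rewrite -(sum_dec (fun f => \prod_k (A k (dec i k) (f k) * B k (f k) (dec j k)))).
rewrite -(bigA_distr_bigA (fun k c => A k (dec i k) c * B k c (dec j k))) /=.
by apply: eq_bigr => k _; rewrite mxE.
Qed.

Lemma tens_adj n (A : 'I_n -> 'M[C]_d) :
  adj (tens_fam A) = tens_fam (fun k => adj (A k)).
Proof.
apply/matrixP => i j; rewrite adjE !tens_famE rmorph_prod /=.
by apply: eq_bigr => k _; rewrite adjE.
Qed.

Lemma tens_diag n (w : 'I_n -> 'I_d -> R) :
  tens_fam (fun k => diag_mx (\row_a (w k a)%:C)) =
  diag_mx (\row_b (\prod_k w k (dec b k))%:C) :> 'M[C]_(d ^ n).
Proof.
apply/matrixP => i j; rewrite tens_famE !mxE.
have [->|ij] := eqVneq i j.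
  by rewrite mulr1n rmorph_prod; apply: eq_bigr => k _; rewrite !mxE eqxx mulr1n.
rewrite mulr0n; have [k hk] : exists k, dec i k != dec j k.
  apply: contrapT => h; case/eqP: ij; apply: dec_inj; apply/ffunP => k.
  by apply: contrapT => /eqP hk; apply: h; exists k.
by rewrite (bigD1 k) //= !mxE (negbTE hk) mulr0n mul0r.
Qed.

Lemma tens1 n : tens_fam (fun _ : 'I_n => 1%:M : 'M[C]_d) = 1%:M.
Proof.
have e1 m : 1%:M = diag_mx (\row_a (1 : R)%:C) :> 'M[C]_m.
  rewrite (_ : (\row_a _) = const_mx 1) ?diag_const_mx //.
  by apply/rowP => a; rewrite !mxE.
rewrite e1 tens_diag e1; congr diag_mx; apply/rowP => b; rewrite !mxE.
by rewrite big1.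
Qed.

Lemma tens_unitary n (U : 'I_n -> 'M[C]_d) :
  (forall k, U k *m adj (U k) = 1%:M) ->
  tens_fam U *m adj (tens_fam U) = 1%:M.
Proof.
by move=> h; rewrite tens_adj tens_mul -tens1; congr tens_fam; apply: funext.
Qed.

Lemma tens_udu n (U : 'I_n -> 'M[C]_d) (w : 'I_n -> 'I_d -> R) :
  tens_fam (fun k => udu (U k) (w k)) =
  udu (tens_fam U) (fun b => \prod_k w k (dec b k)).
Proof. by rewrite /udu tens_adj -tens_diag !tens_mul. Qed.

Lemma tens_diag_entry n (A : 'I_n -> 'M[C]_d) (r : 'I_n -> 'I_d -> R) b :
  (forall k a, A k a a = (r k a)%:C) ->
  Re (tens_fam A b b) = \prod_k r k (dec b k).
Proof.
move=> h; rewrite tens_famE (eq_bigr (fun k => (r k (dec b k))%:C)) //.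
by rewrite -rmorph_prod.
Qed.

(** Entrywise, the product over positions of sums over letters expands into a sum over words. *)
Lemma avgn_prod (X : finType) (W : X -> 'M[C]_d) (p : {ffun X -> R}) n :
  avgn W [ffun xn : {ffun 'I_n -> X} => \prod_i p (xn i)] =
  tens_fam (fun _ : 'I_n => avg W p).
Proof.
apply/matrixP => i j; rewrite tens_famE /avgn summxE.
transitivity (\sum_(xn : {ffun 'I_n -> X}) \prod_k ((p (xn k))%:C *
                 W (xn k) (dec i k) (dec j k))).
  apply: eq_bigr => xn _; rewrite mxE ffunE /Wn tens_famE rmorph_prod.
  by rewrite -big_split.
rewrite -(bigA_distr_bigA (fun k x => (p x)%:C * W x (dec i k) (dec j k))) /=.
by apply: eq_bigr => k _; rewrite /avg summxE; apply: eq_bigr => x _; rewrite mxE.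
Qed.

End Tensor.

(** * Density matrices, row-space projections and eigenvalue counting *)

Section Density.
Local Open Scope complex_scope.
Variable R : realType.
Local Notation C := (R[i]).
Local Notation Re := (@complex.Re R).

Lemma quad_colE d (U A : 'M[C]_d) a :
  (adj U *m A *m U) a a = (adj (col a U) *m A *m col a U) 0 0.
Proof.
rewrite [RHS]mxE [LHS]mxE; apply: eq_bigr => j _; rewrite [col a U j 0]mxE.
congr (_ * _); rewrite [RHS]mxE [LHS]mxE; apply: eq_bigr => k _.
by rewrite !adjE mxE.
Qed.

Lemma udu_quad d (U : 'M[C]_d) (w : 'I_d -> R) a : U *m adj U = 1%:M ->
  (adj U *m udu U w *m U) a a = (w a)%:C.
Proof.
move=> hU; rewrite /udu !mulmxA (mulmx1C hU) mul1mx -mulmxA (mulmx1C hU) mulmx1.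
by rewrite !mxE eqxx mulr1n.
Qed.

(* [i (A - adj A)] is hermitian with vanishing quadratic form, hence zero. *)
Lemma psd_herm d (A : 'M[C]_d) : psd A -> adj A = A.
Proof.
move=> h; pose H : 'M[C]_d := (Complex 0 1) *: (A - adj A).
have hH : adj H = H.
  apply/matrixP => i j; rewrite /adj /H !mxE.
  by case: (A j i) => a b; case: (A i j) => a' b'; simpc; congr Complex; ring.
have [U [w [hU eH]]] := herm_spec hH.
have w0 a : w a = 0.
  have /(congr1 Re) := udu_quad w a hU; rewrite -eH /= => <-.
  rewrite quad_colE /H -scalemxAr -scalemxAl mxE mulmxBr mulmxBl mxE.
  set v := col a U; have hv := h v.
  have -> : (adj v *m adj A *m v) = adj (adj v *m A *m v).
    by rewrite !adjM adjK mulmxA.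
  rewrite [X in _ + X]mxE adjE; move: hv; set z := (_ *m _) 0 0.
  by case: z => x y; rewrite lecE /= => /andP[/eqP -> _]; simpc; ring.
have H0 : H = 0.
  rewrite eH /udu (_ : (\row_a _) = 0) ?linear0 ?mulmx0 ?mul0mx //.
  by apply/rowP => a; rewrite !mxE w0.
have /eqP : A - adj A = 0.
  by move/eqP: H0; rewrite /H scaler_eq0 => /orP[/eqP[/eqP]|/eqP //]; rewrite oner_eq0.
by rewrite subr_eq0 => /eqP.
Qed.

Lemma psd_udu_ge0 d (U : 'M[C]_d) (w : 'I_d -> R) : U *m adj U = 1%:M ->
  psd (udu U w) -> forall a, 0 <= w a.
Proof.
move=> hU h a; have := h (col a U); rewrite -quad_colE udu_quad // lecE /=.
by case/andP.
Qed.

Lemma density_spec d (A : 'M[C]_d) : density A ->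
  exists (U : 'M[C]_d) (w : 'I_d -> R),
  [/\ U *m adj U = 1%:M, A = udu U w, forall a, 0 <= w a & \sum_a w a = 1].
Proof.
move=> [hp ht]; have [U [w [hU eA]]] := herm_spec (psd_herm hp).
exists U, w; split => //; first by apply: (psd_udu_ge0 hU); rewrite -eA.
by rewrite -(rtr_udu w hU) -eA /rtr ht.
Qed.

Lemma psd_sum d (I : finType) (F : I -> 'M[C]_d) : (forall i, psd (F i)) ->
  psd (\sum_i F i).
Proof.
move=> h v; rewrite mulmx_sumr mulmx_suml summxE.
by apply: sumr_ge0 => i _; exact: h.
Qed.

Lemma psdZ d (a : R) (A : 'M[C]_d) : 0 <= a -> psd A -> psd (a%:C *: A).
Proof.
move=> a0 h v; rewrite -scalemxAr -scalemxAl mxE mulr_ge0 ?ler0c //; exact: h.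
Qed.

Lemma density_mix d (X : finType) (W : X -> 'M[C]_d) (p : X -> R) :
  (forall x, density (W x)) -> (forall x, 0 <= p x) -> \sum_x p x = 1 ->
  density (\sum_x (p x)%:C *: W x).
Proof.
move=> hW p0 p1; split.
  by apply: psd_sum => x; apply: psdZ => //; case: (hW x).
rewrite raddf_sum -[RHS]/((1 : R)%:C) -p1 rmorph_sum; apply: eq_bigr => x _ /=.
by rewrite mxtraceZ; case: (hW x) => _ ->; rewrite mulr1.
Qed.

Lemma udu_density d (U : 'M[C]_d) (w : 'I_d -> R) : U *m adj U = 1%:M ->
  (forall a, 0 <= w a) -> \sum_a w a = 1 -> density (udu U w).
Proof.
move=> hU w0 w1; split.
  move=> v; rewrite /udu !mulmxA -(mulmxA _ (adj U)).
  set u := adj U *m v; have -> : adj v *m U = adj u by rewrite /u adjM adjK.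
  rewrite mxE; apply: sumr_ge0 => a _; rewrite mul_mx_diag !mxE.
  rewrite mulrAC mulr_ge0 //; first by rewrite mulrC mulcJ_ge0.
  by rewrite ler0c.
rewrite /udu mxtrace_mulC mulmxA (mulmx1C hU) mul1mx mxtrace_diag.
by rewrite -[RHS]/((1 : R)%:C) -w1 rmorph_sum; apply: eq_bigr => a _; rewrite mxE.
Qed.

(** Orthonormalise a basis of the row space into the rows of [B]; then [adj B *m B] projects onto
    it. The factorisation [T = K *m A] ensures that [A *m Q = 0] implies [T *m Q = 0]. *)
Lemma proj_rowspace d (A : 'M[C]_d) : exists T : 'M[C]_d,
  [/\ proj T, A *m T = A, exists K, T = K *m A & rtr T = (\rank A)%:R].
Proof.
pose B := schmidt (row_base A).
have hB : B *m adj B = 1%:M.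
  by apply/unitarymxP/schmidt_unitarymx/rank_leq_col.
have eB : (B :=: A)%MS.
  exact: eqmx_trans (eqmx_schmidt_free (row_base_free A)) (eq_row_base A).
have [D eD] : exists D, A = D *m B by apply/submxP; rewrite eB.
have [K eK] : exists K, B = K *m A by apply/submxP; rewrite eB.
exists (adj B *m B); split.
- split; first by rewrite adjM adjK.
  by rewrite -mulmxA (mulmxA B) hB mul1mx.
- by rewrite {1}eD -mulmxA (mulmxA B) hB mul1mx.
- by exists (adj B *m K); rewrite -mulmxA -eK.
- by rewrite rtrC hB /rtr mxtrace1; elim: (\rank A) => // n; rewrite !mulrS ReD => ->.
Qed.

Lemma rank_proj_udu d (U : 'M[C]_d) (P : pred 'I_d) :
  (\rank (udu U (fun a => (P a)%:R)) <= #|P|)%N.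
Proof.
apply: leq_trans (mxrankM_maxl _ _) _; apply: leq_trans (mxrankM_maxr _ _) _.
rewrite (_ : diag_mx _ = \sum_(a in P) delta_mx a a); last first.
  apply/matrixP => i j; rewrite summxE !mxE.
  under eq_bigr => a _ do rewrite mxE.
  have [->|ij] := eqVneq i j; last first.
    rewrite mulr0n big1 // => a _; case: eqP => // <-; case: eqP => // e.
    by rewrite e eqxx in ij.
  rewrite mulr1n; case Pj: (P j).
    rewrite (bigD1 j) //= eqxx big1 ?addr0 // => a /andP[_ /negbTE aj].
    by rewrite eq_sym aj.
  rewrite big1 // => a Pa; case: eqP => // e.
  by move: Pa; rewrite -e /in_mem /= Pj.
rewrite -sum1_card.
apply: (big_ind2 (fun (M : 'M[C]_d) n => (\rank M <= n)%N)).
- by rewrite mxrank0.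
- by move=> M1 n1 M2 n2 h1 h2; apply: leq_trans (mxrank_add _ _) (leq_add h1 h2).
- by move=> a _; rewrite mxrank_delta.
Qed.

(** Each counted eigenvalue contributes at least [t] to a total of at most 1. *)
Lemma card_ge_threshold (A : finType) (w : A -> R) (t : R) : 0 < t ->
  (forall a, 0 <= w a) -> \sum_a w a <= 1 ->
  #|[pred a | t <= w a]|%:R <= t^-1.
Proof.
move=> t0 w0 w1; rewrite -[leRHS]mul1r ler_pdivlMr //; apply: le_trans w1.
rewrite (bigID [pred a | t <= w a]) /=.
apply: (@le_trans _ _ (\sum_(a | t <= w a) w a)); last by rewrite lerDl sumr_ge0.
rewrite mulr_natl -sumr_const; apply: ler_sum => a //.
Qed.

Lemma sum_threshold_le (A : finType) (w : A -> R) (t : R) : 0 < t ->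
  (forall a, 0 <= w a) -> \sum_a w a = 1 -> \sum_a (t <= w a)%R%:R <= t^-1.
Proof.
move=> t0 w0 w1; apply: le_trans (card_ge_threshold t0 w0 _); last by rewrite w1.
rewrite -sum1_card natr_sum [leRHS]big_mkcond; apply: ler_sum => a _.
by rewrite inE; case: (t <= w a)%R.
Qed.

End Density.

(** * One-shot covering by random sampling *)

Section Covering.
Local Open Scope complex_scope.
Variable R : realType.
Local Notation C := (R[i]).
Local Notation Re := (@complex.Re R).
Local Notation Im := (@complex.Im R).

Definition low_part (D : nat) (w : 'I_D -> R) (theta : R) (a : 'I_D) : R :=
  w a * (w a <= theta)%R%:R.

Lemma low_part_ge0 D (w : 'I_D -> R) theta a : (forall a, 0 <= w a) ->
  0 <= low_part w theta a.
Proof. by move=> h; rewrite mulr_ge0. Qed.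

Lemma low_part_le D (w : 'I_D -> R) theta a : (forall a, 0 <= w a) ->
  low_part w theta a <= w a.
Proof. by move=> h; rewrite /low_part ler_piMr //; case: (w a <= theta)%R. Qed.

Lemma halves_le (k x y b : R) : 0 < k -> x <= b -> y <= 1 ->
  (k * y + x / k) / 2 <= (b / k + k) / 2.
Proof.
move=> k0 hx hy; rewrite ler_pM2r ?invr_gt0 // addrC lerD //.
  by rewrite ler_pM2r ?invr_gt0.
by rewrite ler_piMr // ltW.
Qed.

(** With [W'] the cut state, the difference splits into the removed tail, [(1-P) W'] and
    [P W' (1-P)]. The tail costs [d1], and weighted Cauchy-Schwarz bounds each other piece by
    [(d1/k + k)/2]. Testing against a fixed [S] avoids trace norms of non-hermitian pieces. *)
Lemma gentle_cut D (U P S : 'M[C]_D) (w : 'I_D -> R) (theta d1 k : R) :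
  U *m adj U = 1%:M -> (forall a, 0 <= w a) -> \sum_a w a = 1 ->
  proj P -> adj S = S -> S *m S = 1%:M ->
  \sum_a w a * (theta < w a)%R%:R <= d1 ->
  rtr ((1%:M - P) *m udu U w) <= d1 -> 0 < k ->
  rtr ((udu U w - P *m udu U (low_part w theta) *m P) *m S) <= d1 + (k + d1 / k).
Proof.
move=> hU w0 w1 hP hS SS htail hPW k0.
set w' := low_part w theta; set E := 1%:M - P.
have w'0 a : 0 <= w' a by apply: low_part_ge0.
have w'w a : w' a <= w a by apply: low_part_le.
have [E1 E2] := projC hP; rewrite -/E in E1 E2; have [P1 P2] := hP.
(* A square root of the cut state, which turns each mixed term into a product suited to
   [rtr_mul_le]. *)
pose G := U *m diag_mx (\row_a (Num.sqrt (w' a))%:C).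
have GG : G *m adj G = udu U w'.
  rewrite /G adjM diag_real_adj /udu !mulmxA -(mulmxA U) mulmx_diag.
  congr (_ *m diag_mx _ *m _); apply/rowP => a; rewrite !mxE -rmorphM /=.
  by rewrite -expr2 sqr_sqrtr.
clearbody G.
have W'1 : rtr (udu U w') <= 1 by rewrite rtr_udu // -w1 ler_sum.
have EW' : rtr (E *m udu U w') <= d1.
  apply: le_trans hPW; rewrite !rtr_mul_udu; apply: ler_sum => a _.
  by rewrite ler_wpM2r //; case/andP: (proj_diag a hU (projC hP)).
have PW' : rtr (P *m udu U w') <= 1.
  by apply: le_trans W'1; rewrite rtr_udu //; case/andP: (rtr_proj_udu_le hU hP w'0).
have -> : udu U w - P *m udu U w' *m P =
    (udu U w - udu U w') + E *m udu U w' + P *m udu U w' *m E.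
  rewrite /E mulmxBl mul1mx mulmxBr mulmx1.
  by rewrite !addrA !subrK.
clearbody E; rewrite !mulmxDl !rtrD -rtrD -mulmxDl.
have t1 : rtr ((udu U w - udu U w') *m S) <= d1.
  rewrite udu_opp udu_add; apply: le_trans (ler_norm _) _.
  apply: le_trans (rtr_hunitary_udu_le hU _ _) _; first by rewrite hS.
    by move=> a; rewrite subr_ge0.
  apply: le_trans htail; apply: ler_sum => a _; rewrite /w' /low_part.
  by case: leP => _; rewrite ?mulr1 ?mulr0 ?subr0 ?subrr.
have t2 : rtr (E *m udu U w' *m S) <= (d1 / k + k) / 2.
  rewrite -GG (mulmxA E) -mulmxA.
  have ki : 0 < k^-1 by rewrite invr_gt0.
  apply: le_trans (rtr_mul_le _ _ ki) _.
  rewrite !adjM adjK hS E1 !mulmxA -(mulmxA E G) GG.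
  rewrite -(mulmxA S G) GG invrK.
  have -> : rtr (E *m udu U w' *m E) = rtr (E *m udu U w') by rewrite rtrC mulmxA E2.
  have -> : rtr (S *m udu U w' *m S) = rtr (udu U w') by rewrite rtrC mulmxA SS mul1mx.
  rewrite addrC [k^-1 * _]mulrC [_ * k]mulrC; exact: halves_le.
have t3 : rtr (P *m udu U w' *m E *m S) <= (d1 / k + k) / 2.
  rewrite -GG (mulmxA P) -!mulmxA (mulmxA P).
  apply: le_trans (rtr_mul_le _ _ k0) _.
  rewrite !adjM adjK hS E1 P1 !mulmxA -(mulmxA P G) GG.
  rewrite -(mulmxA (S *m E) G) GG.
  have -> : rtr (P *m udu U w' *m P) = rtr (P *m udu U w') by rewrite rtrC mulmxA P2.
  have -> : rtr (S *m E *m udu U w' *m E *m S) = rtr (E *m udu U w').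
    by move: (udu U w') => Z; rewrite [LHS]rtrC !mulmxA SS mul1mx [LHS]rtrC mulmxA E2.
  exact: halves_le.
by apply: le_trans (lerD (lerD t1 t2) t3) _; rewrite -addrA -splitr [k + _]addrC.
Qed.

(** Pythagoras: the two sides differ by the squared norm of [(1 - P) *m B]. *)
Lemma hsip_projl m n (P : 'M[C]_m) (B : 'M[C]_(m, n)) : proj P ->
  hsip (P *m B) (P *m B) <= hsip B B.
Proof.
move=> hP; have [E1 E2] := projC hP; have [P1 P2] := hP.
have h := hsip_ge0 ((1%:M - P) *m B).
have e (Q : 'M[C]_m) : adj Q = Q -> Q *m Q = Q ->
    hsip (Q *m B) (Q *m B) = rtr (adj B *m Q *m B).
  by move=> h1 h2; rewrite -rtr_hsip adjM h1 !mulmxA -(mulmxA (adj B) Q) h2.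
rewrite e // in h; rewrite e // -[hsip B B]rtr_hsip.
by rewrite mulmxBr mulmx1 mulmxBl rtrB subr_ge0 in h.
Qed.

Lemma hsip_adj m n (B : 'M[C]_(m, n)) : hsip (adj B) (adj B) = hsip B B.
Proof. by rewrite -!rtr_hsip adjK rtrC. Qed.

Lemma hsip_projr m n (P : 'M[C]_n) (B : 'M[C]_(m, n)) : proj P ->
  hsip (B *m P) (B *m P) <= hsip B B.
Proof.
move=> hP; rewrite -hsip_adj -[leRHS]hsip_adj adjM; have [-> _] := hP.
exact: hsip_projl.
Qed.

(** First-moment method: a positive gap everywhere would force every weight [mu f] to vanish. *)
Lemma avg_exists (F : finType) (mu Phi : F -> R) (c : R) :
  (forall f, 0 <= mu f) -> \sum_f mu f = 1 -> \sum_f mu f * Phi f <= c ->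
  exists f, Phi f <= c.
Proof.
move=> mu0 mu1 h; apply: contrapT => /forallNP hn.
have hlt f : c < Phi f by rewrite ltNge; apply/negP; exact: hn.
have h0 : \sum_f mu f * (Phi f - c) = 0.
  apply/eqP; rewrite eq_le; apply/andP; split; last first.
    by apply: sumr_ge0 => f _; rewrite mulr_ge0 // subr_ge0 ltW.
  under eq_bigr do rewrite mulrBr.
  by rewrite sumrB -mulr_suml mu1 mul1r subr_le0.
have : \sum_f mu f = 0.
  apply: big1 => f _; have : mu f * (Phi f - c) = 0.
    by apply: (psumr_eq0P _ h0) => // g _; rewrite mulr_ge0 // subr_ge0 ltW.
  by move/eqP; rewrite mulf_eq0 subr_eq0 (gt_eqF (hlt f)) orbF => /eqP.
by rewrite mu1 => /eqP; rewrite oner_eq0.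
Qed.

(** Real and imaginary parts of each entry are deviations of scalar sample means, so the matrix
    variance is a sum of scalar ones. *)
Lemma emp_hsip_var (T : finType) (M D : nat) (p : T -> R) (B : T -> 'M[C]_D)
    (Y : {ffun 'I_M -> T} -> 'M[C]_D) :
  (0 < M)%N -> (forall x, 0 <= p x) -> \sum_x p x = 1 ->
  (forall f, Y f = \sum_x (p x - emp R f x)%:C *: B x) ->
  \sum_(f : {ffun 'I_M -> T}) (\prod_i p (f i)) * hsip (Y f) (Y f) <=
  (\sum_x p x * hsip (B x) (B x)) / M%:R.
Proof.
move=> M0 p0 p1 hY.
pose zr i j x := Re (B x i j); pose zi i j x := Im (B x i j).
have eY f i j : Re (Y f i j) = \sum_x (p x - emp R f x) * zr i j x /\
    Im (Y f i j) = \sum_x (p x - emp R f x) * zi i j x.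
  rewrite hY summxE Re_sum Im_sum; split; apply: eq_bigr => x _; rewrite mxE.
    by rewrite Re_realM.
  by rewrite Im_realM.
have eh (f : {ffun 'I_M -> T}) : (\prod_i p (f i)) * hsip (Y f) (Y f) =
    \sum_i \sum_j ((\prod_i p (f i)) * (\sum_x (p x - emp R f x) * zr i j x) ^+ 2 +
                  (\prod_i p (f i)) * (\sum_x (p x - emp R f x) * zi i j x) ^+ 2).
  rewrite /hsip mulr_sumr; apply: eq_bigr => i _; rewrite mulr_sumr.
  by apply: eq_bigr => j _; rewrite (proj1 (eY f i j)) (proj2 (eY f i j)) mulrDr.
rewrite (eq_bigr _ (fun f _ => eh f)).
have ehB x : p x * hsip (B x) (B x) =
    \sum_i \sum_j (p x * zr i j x ^+ 2 + p x * zi i j x ^+ 2).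
  rewrite /hsip mulr_sumr; apply: eq_bigr => i _; rewrite mulr_sumr.
  by apply: eq_bigr => j _; rewrite mulrDr.
rewrite [X in _ <= X / _](eq_bigr _ (fun x _ => ehB x)).
rewrite exchange_big [X in _ <= X / _]exchange_big mulr_suml /=.
apply: ler_sum => i _.
rewrite exchange_big [X in _ <= X / _]exchange_big mulr_suml /=.
apply: ler_sum => j _.
rewrite !big_split /= mulrDl.
by apply: lerD; exact: emp_var.
Qed.

(** Elements of [T] are grouped by [typ]; class [k] has its own projection, of trace at most [r k]
    when the class occurs, and its own cut [theta k]. The error is the cost of [gentle_cut], a share
    [gam] per class, and the variance bound [G / M] divided by [gam]. *)
Lemma oneshot_covering (T K : finType) (typ : T -> K) (D : nat)
    (U : T -> 'M[C]_D) (w : T -> 'I_D -> R) (Pi : K -> 'M[C]_D)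
    (r theta : K -> R) (d1 G gam kap : R) (M : nat) (p : T -> R) :
  (forall x, U x *m adj (U x) = 1%:M) -> (forall x a, 0 <= w x a) ->
  (forall x, \sum_a w x a = 1) -> (forall k, proj (Pi k)) ->
  (forall k, 0 < r k) -> (forall k, 0 <= theta k) ->
  (forall x, rtr (Pi (typ x)) <= r (typ x)) ->
  (forall x, \sum_a w x a * (theta (typ x) < w x a)%R%:R <= d1) ->
  (forall x, rtr ((1%:M - Pi (typ x)) *m udu (U x) (w x)) <= d1) ->
  (forall x, r (typ x) * theta (typ x) <= G) ->
  (forall x, 0 <= p x) -> \sum_x p x = 1 ->
  (0 < M)%N -> 0 < gam -> 0 < kap ->
  exists f : {ffun 'I_M -> T},
    trnorm (\sum_x (p x)%:C *: udu (U x) (w x) -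
            \sum_x (emp R f x)%:C *: udu (U x) (w x)) / 2 <=
    d1 + (kap + d1 / kap) + (#|K|%:R * gam + G / (gam * M%:R)).
Proof.
move=> hU w0 w1 hPi r0 th0 hr htail hPiW hG p0 p1 M0 g0 k0.
set W := fun x => udu (U x) (w x).
pose A x := Pi (typ x) *m udu (U x) (low_part (w x) (theta (typ x))) *m Pi (typ x).
have hA x : hsip (A x) (A x) <= theta (typ x).
  apply: le_trans (hsip_projr _ (hPi _)) _.
  apply: le_trans (hsip_projl _ (hPi _)) _.
  rewrite -rtr_hsip udu_adj udu_mul // rtr_udu //.
  rewrite -[leRHS]mulr1 -(w1 x) mulr_sumr; apply: ler_sum => a _.
  rewrite /low_part; case: (leP (w x a)) => h; rewrite ?mulr1 ?mulr0 ?mul0r.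
    by rewrite ler_wpM2r.
  by rewrite mulr_ge0.
pose B k x := if typ x == k then A x else 0.
pose Y k (f : {ffun 'I_M -> T}) := \sum_x (p x - emp R f x)%:C *: B k x.
(* The weights [r k] combine all classes into one functional of mean at most [G / M], so a single
   sample [f] serves them simultaneously. *)
pose Phi f := \sum_k r k * hsip (Y k f) (Y k f).
have hsip0 : hsip (0 : 'M[C]_D) 0 = 0.
  by rewrite -rtr_hsip mulmx0 rtr0.
have hPhi : \sum_(f : {ffun 'I_M -> T}) (\prod_i p (f i)) * Phi f <= G / M%:R.
  rewrite /Phi; under eq_bigr do rewrite mulr_sumr.
  rewrite exchange_big /=.
  apply: (@le_trans _ _ (\sum_k (\sum_x p x * (r k * hsip (B k x) (B k x))) / M%:R)).
    apply: ler_sum => k _; under eq_bigr do rewrite mulrCA.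
    rewrite -mulr_sumr; under [in leRHS]eq_bigr do rewrite mulrCA.
    rewrite -mulr_sumr -mulrA ler_pM2l //.
    exact: emp_hsip_var.
  rewrite -mulr_suml ler_pM2r ?invr_gt0 ?ltr0n // exchange_big /=.
  rewrite -[leRHS]mul1r -p1 mulr_suml; apply: ler_sum => x _.
  rewrite -mulr_sumr ler_wpM2l // (bigD1 (typ x)) //= /B eqxx big1 ?addr0.
    by apply: le_trans (hG x); rewrite ler_wpM2l // ltW.
  by move=> k; rewrite eq_sym => /negbTE ->; rewrite hsip0 mulr0.
have [|f hf] := avg_exists _ (sum_prod_dist (fun _ : 'I_M => p1)) hPhi.
  by move=> f; apply: prodr_ge0.
exists f.
have -> : \sum_x (p x)%:C *: W x - \sum_x (emp R f x)%:C *: W x =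
    \sum_x (p x - emp R f x)%:C *: W x.
  by rewrite -sumrB; apply: eq_bigr => x _; rewrite rmorphB scalerBl.
set De := \sum_x _.
have hDe : adj De = De.
  by rewrite /De adj_sum; apply: eq_bigr => x _; rewrite adjZ udu_adj.
have [S [hS SS ->]] := trnorm_attained hDe.
pose e1 := d1 + (kap + d1 / kap).
have hcut x : `|rtr ((W x - A x) *m S)| <= e1.
  rewrite ler_norml; apply/andP; split; last exact: gentle_cut.
  rewrite lerNl -rtrN -mulmxN; apply: gentle_cut => //; first by rewrite adjN hS.
  by rewrite mulmxN mulNmx opprK.
have q0 x : 0 <= emp R f x by have [[q0 _] _] := emp_probM R f M0.
have q1 : \sum_x emp R f x = 1 by have [[_ q1] _] := emp_probM R f M0.
(* Apart from the cutting error, the deviation is a sum of the fluctuations [Y k f] of the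
   classes. *)
have eDe : rtr (De *m S) = \sum_x (p x - emp R f x) * rtr ((W x - A x) *m S) +
    \sum_k rtr (Y k f *m S).
  have -> : \sum_k rtr (Y k f *m S) = rtr ((\sum_x (p x - emp R f x)%:C *: A x) *m S).
    rewrite -rtr_sum -mulmx_suml /Y exchange_big /=; congr (rtr (_ *m S)).
    apply: eq_bigr => x _; rewrite -scaler_sumr; congr (_ *: _).
    rewrite (bigD1 (typ x)) //= {1}/B eqxx big1 ?addr0 // => k.
    by rewrite /B eq_sym => /negbTE ->.
  rewrite /De !mulmx_suml !rtr_sum -big_split /=; apply: eq_bigr => x _.
  by rewrite -!scalemxAl !rtrZ mulmxBl rtrB -mulrDr subrK.
have b1 : \sum_x (p x - emp R f x) * rtr ((W x - A x) *m S) <= 2 * e1.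
  apply: (@le_trans _ _ (\sum_x (p x + emp R f x) * e1)).
    apply: ler_sum => x _; have := hcut x; rewrite ler_norml => /andP[h1 h2].
    rewrite mulrBl mulrDl; apply: lerD; first by rewrite ler_wpM2l.
    by rewrite -mulrN ler_wpM2l // lerNl.
  by rewrite -mulr_suml big_split /= p1 q1.
have b2 : \sum_k rtr (Y k f *m S) <= #|K|%:R * gam + Phi f / gam.
  rewrite mulr_natl -sumr_const /Phi mulr_suml -big_split /=; apply: ler_sum => k _.
  (* The trace bound on [Pi k] is known only for classes that occur; the others have [Y k f = 0]. *)
  case: (pselect (exists x, typ x = k)) => [[x0 ek]|hk]; last first.
    have -> : Y k f = 0.
      apply: big1 => x _; rewrite /B; case: eqP => [e|_]; last exact: scaler0.
      by case: hk; exists x.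
    by rewrite mul0mx rtr0 hsip0 mulr0 mul0r addr0 ltW.
  have [P1 P2] := hPi k.
  have -> : Y k f *m S = Y k f *m (Pi k *m S).
    rewrite mulmxA; congr (_ *m _); rewrite /Y mulmx_suml; apply: eq_bigr => x _.
    rewrite -scalemxAl /B; case: eqP => [e|_]; last by rewrite mul0mx.
    by rewrite /A -!mulmxA e P2.
  (* This weight in Cauchy-Schwarz caps the trace term at [gam] and turns the other into the class's
     term of [Phi f / gam], before halving. *)
  have kk : 0 < r k / gam by rewrite divr_gt0.
  apply: le_trans (rtr_mul_le _ _ kk) _.
  have -> : rtr (Y k f *m adj (Y k f)) = hsip (Y k f) (Y k f).
    by rewrite rtrC rtr_hsip.
  have -> : rtr (adj (Pi k *m S) *m (Pi k *m S)) = rtr (Pi k).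
    by rewrite adjM hS P1 !mulmxA -(mulmxA S) P2 rtrC mulmxA SS mul1mx.
  have h1 : rtr (Pi k) / (r k / gam) <= gam.
    by rewrite ler_pdivrMr // mulrCA mulfV ?gt_eqF // mulr1 -ek.
  have h2 : 0 <= r k * hsip (Y k f) (Y k f) / gam.
    by rewrite mulr_ge0 ?invr_ge0 ?mulr_ge0 ?hsip_ge0 // ltW.
  rewrite mulrAC; lra.
have b3 : Phi f / gam <= G / (gam * M%:R).
  by rewrite invfM [gam^-1 * _]mulrC mulrA ler_pM2r // invr_gt0.
rewrite eDe; rewrite -/e1.
have : 0 <= #|K|%:R * gam + Phi f / gam.
  rewrite addr_ge0 ?mulr_ge0 ?invr_ge0 ?(ltW g0) //.
  by apply: sumr_ge0 => k _; rewrite mulr_ge0 ?hsip_ge0 // ltW.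
lra.
Qed.

End Covering.

(** * One-shot strong converse by a projective test and a union bound *)

Section Converse.
Local Open Scope complex_scope.
Variable R : realType.
Local Notation C := (R[i]).
Local Notation Re := (@complex.Re R).

(** Used with [c = L^-1]: the mass that a state leaves outside at most [L] eigenvectors. *)
Definition small_mass (D : nat) (w : 'I_D -> R) (c : R) : R :=
  \sum_a w a * (w a < c)%R%:R.

Lemma sum_diag_rtr D (V F : 'M[C]_D) : V *m adj V = 1%:M ->
  \sum_b Re ((adj V *m F *m V) b b) = rtr F.
Proof.
move=> hV; rewrite -[in RHS](mulmx1 F) -(udu1 hV) rtr_mul_udu.
by apply: eq_bigr => b _; rewrite mul1r.
Qed.

Lemma rtr_mix D (T : finType) (F : 'M[C]_D) (q : T -> R) (W : T -> 'M[C]_D) :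
  rtr (F *m (\sum_x (q x)%:C *: W x)) = \sum_x q x * rtr (F *m W x).
Proof.
by rewrite mulmx_sumr rtr_sum; apply: eq_bigr => x _; rewrite -scalemxAr rtrZ.
Qed.

Section Test.
Variables (T : finType) (D : nat) (U : T -> 'M[C]_D) (w : T -> 'I_D -> R).
Hypothesis hU : forall x, U x *m adj (U x) = 1%:M.
Hypothesis w0 : forall x a, 0 <= w x a.
Hypothesis w1 : forall x, \sum_a w x a = 1.
Let W x := udu (U x) (w x).

Variables (V : 'M[C]_D) (s : 'I_D -> R).
Hypothesis hV : V *m adj V = 1%:M.
Hypothesis s1 : \sum_b s b = 1.

(* [T0] projects onto the span of the large-eigenvalue spaces of the [W (f i)]
   cut down by [1 - Q]: it sees almost all of their mixture outside [Q], but,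
   having small rank, almost nothing of [udu V s] there. *)
Lemma overlap_test (N : nat) (f : {ffun 'I_N -> T}) (L tau : R) (Q : 'M[C]_D) :
  (0 < N)%N -> 0 < L -> 0 < tau -> Q = udu V (fun b => (tau <= s b)%R%:R) ->
  1 <= trnorm (\sum_x (emp R f x)%:C *: W x - udu V s) / 2 + N%:R * L * tau +
       (\sum_i (rtr (Q *m W (f i)) + small_mass (w (f i)) L^-1)) / N%:R.
Proof.
move=> N0 L0 t0 eQ; set E := 1%:M - Q.
have NR : 0 < N%:R :> R by rewrite ltr0n.
have hQ : proj Q by rewrite eQ; apply: (proj_udu (fun b => (tau <= s b)%R)).
have hE : proj E by apply: projC.
pose P i := udu (U (f i)) (fun a => (L^-1 <= w (f i) a)%R%:R).
have hP i : proj (P i) by apply: (proj_udu (fun a => (L^-1 <= w (f i) a)%R)).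
(* Subspaces are row spaces here; each of the [N] blocks has rank at most [L]. *)
pose A := (\sum_i <<P i *m E>>)%MS.
have [T0 [hT AT [K TK] rT]] := proj_rowspace A.
have EQ : E *m Q = 0 by rewrite mulmxBl mul1mx hQ.2 subrr.
have AE : (A <= E)%MS by apply/sumsmx_subP => i _; rewrite genmxE submxMl.
have TQ : T0 *m Q = 0.
  have [K' eA] := submxP AE; by rewrite TK eA -!mulmxA EQ !mulmx0.
have TE : T0 *m E = T0 by rewrite mulmxBr mulmx1 TQ subr0.
have ET : E *m T0 = T0 by have := congr1 (@adj R D D) TE; rewrite adjM hT.1 hE.1.
(* Compressed by [P i], the test [T0] agrees with [E], hence has the same expectation on the
   large-eigenvalue part of the [i]-th state. *)
have PT i : P i *m T0 = P i *m E.
  have /submxP[K' eK] : (P i *m E <= A)%MS.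
    by apply: (sumsmx_sup i) => //; rewrite genmxE.
  by rewrite -{1}ET mulmxA eK -mulmxA AT.
have rTle : rtr T0 <= N%:R * L.
  rewrite rT; apply: (@le_trans _ _ (\sum_(i < N) \rank (P i *m E))%N%:R).
    rewrite ler_nat; apply: leq_trans (mxrank_sum_leqif _).1 _ => /=.
    by apply: leq_sum => i _; rewrite mxrank_gen.
  have -> : N%:R * L = \sum_(i < N) L by rewrite sumr_const card_ord mulr_natl.
  rewrite natr_sum; apply: ler_sum => i _.
  apply: (@le_trans _ _ #|[pred a | L^-1 <= w (f i) a]|%:R).
    rewrite ler_nat; apply: leq_trans (mxrankM_maxl _ _) _.
    exact: (rank_proj_udu (U (f i)) [pred a | L^-1 <= w (f i) a]).
  by rewrite -[leRHS]invrK; apply: card_ge_threshold; rewrite ?invr_gt0 ?w1.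
(* Since [T0] lies under [E], only eigenvalues below [tau] contribute, in total at most [tau] times
   the trace of [T0]. *)
have Tom : rtr (T0 *m udu V s) <= N%:R * L * tau.
  apply: (@le_trans _ _ (rtr T0 * tau)); last by rewrite ler_pM2r.
  have -> : T0 *m udu V s = T0 *m udu V (fun b => s b * (s b < tau)%R%:R).
    rewrite -{1}TE -mulmxA; congr (_ *m _).
    rewrite /E eQ -(udu1 hV) udu_opp udu_add udu_mul //; apply: eq_udu => b.
    by rewrite mulrC ltNge; case: (_ <= _)%R; rewrite /= ?subrr ?subr0.
  rewrite rtr_mul_udu -(sum_diag_rtr T0 hV) mulr_suml; apply: ler_sum => b _.
  rewrite [leRHS]mulrC; apply: ler_wpM2r; first by case/andP: (proj_diag b hV hT).
  by case: ltP => h; rewrite ?mulr1 ?mulr0 ltW.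
have EW i : rtr (E *m W (f i)) <= rtr (T0 *m W (f i)) + small_mass (w (f i)) L^-1.
  set x := f i; pose wl a := w x a * (L^-1 <= w x a)%R%:R.
  pose ws a := w x a * (w x a < L^-1)%R%:R.
  have wl0 a : 0 <= wl a by rewrite mulr_ge0.
  have eW : W x = udu (U x) wl + udu (U x) ws.
    rewrite udu_add; apply: eq_udu => a; rewrite /wl /ws -mulrDr.
    by case: leP => _; rewrite ?addr0 ?add0r mulr1.
  have ePW : udu (U x) wl = P i *m udu (U x) wl *m P i.
    rewrite /P -/x !udu_mul //; apply: eq_udu => a; rewrite /wl.
    by case: leP => _; rewrite ?(mulr1, mul1r, mulr0, mul0r).
  have e1 : rtr (E *m udu (U x) wl) = rtr (T0 *m udu (U x) wl).
    rewrite ePW; move: (udu (U x) wl) => Z.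
    have e (F P0 : 'M[C]_D) : rtr (F *m (P0 *m Z *m P0)) = rtr (P0 *m F *m P0 *m Z).
      by rewrite !mulmxA rtrC !mulmxA.
    by rewrite !e PT.
  have e2 : rtr (T0 *m udu (U x) wl) <= rtr (T0 *m W x).
    rewrite !rtr_mul_udu; apply: ler_sum => a _.
    apply: ler_wpM2r; first by case/andP: (proj_diag a (hU x) hT).
    by rewrite /wl ler_piMr //; case: (L^-1 <= w x a)%R.
  have e3 : rtr (E *m udu (U x) ws) <= small_mass (w x) L^-1.
    by case/andP: (@rtr_proj_udu_le _ _ (U x) E ws (hU x) hE (fun a => mulr_ge0 (w0 x a) (ler0n _ _))).
  by rewrite {1}eW mulmxDr rtrD e1; apply: lerD.
set rho := \sum_x _; set tn := trnorm _.
have hrho F : rtr (F *m rho) = (\sum_i rtr (F *m W (f i))) / N%:R.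
  by rewrite rtr_mix emp_sumr.
have rho1 : rtr rho = 1.
  rewrite -[rho]mul1mx hrho (eq_bigr (fun=> 1)) => [|i _].
    by rewrite sumr_const card_ord mulfV // gt_eqF.
  by rewrite mul1mx rtr_udu.
have om1 : rtr (udu V s) = 1 by rewrite rtr_udu.
have hTn : rtr (T0 *m rho) <= rtr (T0 *m udu V s) + tn / 2.
  have := @rtr_proj_le_trnorm _ _ (rho - udu V s) T0.
  rewrite mulmxBr !rtrB rho1 om1 subrr lerBlDl => h; apply: h => //.
  rewrite adjB udu_adj /rho adj_sum; congr (_ - _).
  by apply: eq_bigr => x _; rewrite adjZ udu_adj.
have hER : rtr (E *m rho) <= rtr (T0 *m rho) + (\sum_i small_mass (w (f i)) L^-1) / N%:R.
  rewrite !hrho -mulrDl -big_split ler_pM2r ?invr_gt0 //=.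
  by apply: ler_sum => i _; exact: EW.
(* The [E] part of the mixture is passed to [T0], then from the mixture to [udu V s] at the price of
   half the trace norm. *)
have : rtr (Q *m rho) + rtr (E *m rho) = 1.
  by rewrite -rtrD -mulmxDl addrC subrK mul1mx.
rewrite big_split mulrDl /= -hrho; lra.
Qed.

End Test.

(** By contradiction: if each [f] were closer than [e] to some [emp g], [overlap_test] would push
    the average score of that [g] along [f] above [eta]. Chernoff gives each such event probability
    at most [exp(-N/2)], and by [hcount] there are too few [g] to cover all samples. *)
Lemma oneshot_converse (T : finType) (D : nat) (U : T -> 'M[C]_D)
    (w : T -> 'I_D -> R) (p : T -> R) (V : 'M[C]_D) (s : 'I_D -> R)
    (N M : nat) (L tau t eta e : R) :
  (forall x, U x *m adj (U x) = 1%:M) -> (forall x a, 0 <= w x a) ->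
  (forall x, \sum_a w x a = 1) -> (forall x, 0 <= p x) -> \sum_x p x = 1 ->
  V *m adj V = 1%:M -> (forall b, 0 <= s b) ->
  \sum_x (p x)%:C *: udu (U x) (w x) = udu V s ->
  (0 < N)%N -> (0 < M)%N -> 0 < L -> 0 < tau -> 0 < t -> 0 < eta ->
  (t / tau + \sum_b s b * (t < s b)%R%:R + \sum_x p x * small_mass (w x) L^-1)
     * expR (2 / eta) <= eta / 2 ->
  e + N%:R * L * tau + eta <= 1 ->
  (#|T| ^ M)%:R * expR (- (N%:R / 2)) < 1 :> R ->
  exists f : {ffun 'I_N -> T}, forall q : {ffun T -> R}, probM M q ->
    e <= trnorm (\sum_x (emp R f x)%:C *: udu (U x) (w x) -
                 \sum_x (q x)%:C *: udu (U x) (w x)) / 2.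
Proof.
move=> hU w0 w1 p0 p1 hV s0 esig N0 M0 L0 tau0 t0 eta0 hmu he hcount.
have NR : 0 < N%:R :> R by rewrite ltr0n.
set W := fun x => udu (U x) (w x).
apply: contrapT => /forallNP hn.
have hn' (f : {ffun 'I_N -> T}) : exists g : {ffun 'I_M -> T},
    trnorm (\sum_x (emp R f x)%:C *: W x - \sum_x (emp R g x)%:C *: W x) / 2 < e.
  have /existsNP[q /not_implyP[hq /negP]] := hn f; rewrite -ltNge => h.
  by have [g eg] := probM_emp M0 hq; exists g; rewrite -eg.
have dW x : density (W x) by apply: udu_density.
have /choice[V' hV'] (g : {ffun 'I_M -> T}) : exists Vs : 'M[C]_D * ('I_D -> R),
    [/\ Vs.1 *m adj Vs.1 = 1%:M, \sum_x (emp R g x)%:C *: W x = udu Vs.1 Vs.2,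
        forall b, 0 <= Vs.2 b & \sum_b Vs.2 b = 1].
  have [[q0 q1] _] := emp_probM R g M0.
  have [V1 [s1 [h1 h2 h3 h4]]] := density_spec (density_mix dW q0 q1).
  by exists (V1, s1).
pose Q g := udu (V' g).1 (fun b => (tau <= (V' g).2 b)%R%:R).
have hQ g : proj (Q g).
  by have [h1 _ _ _] := hV' g; apply: (proj_udu (fun b => (tau <= (V' g).2 b)%R)).
(* The score: a quantity in [[0, 2]] whose average along [f] is the last term of [overlap_test]. *)
pose a g x := rtr (Q g *m W x) + small_mass (w x) L^-1.
have ha g x : 0 <= a g x <= 2.
  have /andP[h1 h2] := rtr_proj_udu_le (hU x) (hQ g) (w0 x).
  have h3 : 0 <= small_mass (w x) L^-1.
    by apply: sumr_ge0 => b _; rewrite mulr_ge0.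
  have h4 : small_mass (w x) L^-1 <= 1.
    by rewrite -(w1 x); apply: ler_sum => b _; rewrite ler_piMr //; case: (_ < _)%R.
  rewrite w1 in h2; rewrite /a /W; lra.
have hmean g : \sum_x p x * a g x <= t / tau + \sum_b s b * (t < s b)%R%:R +
    \sum_x p x * small_mass (w x) L^-1.
  under eq_bigr do rewrite mulrDr.
  rewrite big_split /= lerD2r -rtr_mix esig rtr_mul_udu.
  (* Eigenvalues of the average state above [t] are charged in full; the rest cost at most [t] times
     the trace of [Q g], that is [t / tau]. *)
  apply: (@le_trans _ _ (\sum_b (t * Re ((adj V *m Q g *m V) b b) +
                                 s b * (t < s b)%R%:R))).
    apply: ler_sum => b _; have /andP[h1 h2] := proj_diag b hV (hQ g).
    case: ltP => h; rewrite ?mulr1 ?mulr0 ?addr0; last by rewrite ler_wpM2r.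
    rewrite ler_wpDl ?mulr_ge0 ?(ltW t0) //.
    by rewrite ler_piMr.
  rewrite big_split /= lerD2r -mulr_sumr sum_diag_rtr // ler_pM2l //.
  have [h1 _ h3 h4] := hV' g; rewrite rtr_udu //.
  exact: sum_threshold_le.
have hch g := @chernoff_prod _ T N p (a g) _ _ p0 p1 (ha g) (hmean g) eta0 hmu.
have hpr (f : {ffun 'I_N -> T}) : 0 <= \prod_i p (f i) by apply: prodr_ge0.
have : 1 <= (#|T| ^ M)%:R * expR (- (N%:R / 2)) :> R; last by rewrite leNgt hcount.
rewrite -[leLHS](sum_prod_dist (fun _ : 'I_N => p1)).
apply: (@le_trans _ _ (\sum_(g : {ffun 'I_M -> T}) \sum_(f : {ffun 'I_N -> T})
   (\prod_i p (f i)) * (N%:R * eta <= \sum_i a g (f i))%R%:R)); last first.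
  apply: (@le_trans _ _ (\sum_(g : {ffun 'I_M -> T}) expR (- (N%:R / 2)))).
    by apply: ler_sum => g _; exact: hch.
  by rewrite sumr_const card_ffun card_ord -[leLHS]mulr_natl.
rewrite exchange_big /=; apply: ler_sum => f _.
have [g hg] := hn' f.
rewrite (bigD1 g) //=; apply: ler_wpDr.
  by apply: sumr_ge0 => g' _; rewrite mulr_ge0.
suff -> : (N%:R * eta <= \sum_i a g (f i))%R by rewrite mulr1.
have [h1 h2 h3 h4] := hV' g.
have := @overlap_test T D U w hU w0 w1 (V' g).1 (V' g).2 h1 h4 N f L tau (Q g) N0 L0 tau0 erefl.
rewrite -h2 => h.
rewrite mulrC -ler_pdivlMr //.
move: h hg; rewrite /a; set x1 := trnorm _ / 2; set x2 := _ / N%:R => h hg.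
lra.
Qed.

End Converse.

(** * Entropies and typicality for product channels *)

Section Entropy.
Local Open Scope complex_scope.
Variable R : realType.
Local Notation C := (R[i]).
Local Notation Re := (@complex.Re R).

(** Minus the von Neumann entropy, in bits, of a state with spectrum [w]. *)
Definition negent (d : nat) (w : 'I_d -> R) : R := \sum_a w a * lg (w a).

Lemma sum1_le1 (A : finType) (w : A -> R) : (forall a, 0 <= w a) ->
  \sum_a w a = 1 -> forall a, 0 <= w a <= 1.
Proof.
move=> w0 w1 a; rewrite w0 /= -w1 (bigD1 a) //= lerDl.
by apply: sumr_ge0.
Qed.

Lemma sum_lg_sqr_le d (w : 'I_d -> R) : (forall a, 0 <= w a) ->
  \sum_a w a = 1 -> \sum_a w a * lg (w a) ^+ 2 <= d%:R * lgsq_max R.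
Proof.
move=> w0 w1; have -> : d%:R * lgsq_max R = \sum_(a < d) lgsq_max R.
  by rewrite sumr_const card_ord mulr_natl.
by apply: ler_sum => a _; apply: mul_lg_sqr_le; exact: sum1_le1.
Qed.

(** From [- y <= 1 + y^2] and the second-moment bound; crude, but enough for the finiteness of the
    capacity. *)
Lemma negent_ge d (w : 'I_d -> R) : (forall a, 0 <= w a) ->
  \sum_a w a = 1 -> - (1 + d%:R * lgsq_max R) <= negent w.
Proof.
move=> w0 w1; rewrite lerNl -sumrN.
apply: (@le_trans _ _ (\sum_a (w a + w a * lg (w a) ^+ 2))).
  apply: ler_sum => a _; rewrite -mulrN -[X in X + _]mulr1 -mulrDr ler_wpM2l //.
  have := sqr_ge0 (lg (w a) + 1 / 2); rewrite expr2; nra.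
by rewrite big_split /= w1 lerD2l sum_lg_sqr_le.
Qed.

Lemma negent_le0 d (w : 'I_d -> R) : (forall a, 0 <= w a) ->
  \sum_a w a = 1 -> negent w <= 0.
Proof.
move=> w0 w1; rewrite -oppr_ge0 -sumrN; apply: sumr_ge0 => a _.
have /andP[h0 h1] := sum1_le1 w0 w1 a.
rewrite -mulrN mulr_ge0 // oppr_ge0 /lg; case: eqP => // _.
by rewrite /log2 pmulr_lle0 ?invr_gt0 ?ln2_gt0 // ln_le0.
Qed.

Lemma herm_diag_real d (A : 'M[C]_d) a : adj A = A -> A a a = (Re (A a a))%:C.
Proof.
move=> h; have : conjc (A a a) = A a a by rewrite -adjE h.
by case: (A a a) => x y /= [] hy; congr Complex; lra.
Qed.

(** In eigen-coordinates the form is a sum of nonnegative terms [l_a |u_a|^2], so each of them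
    vanishes, and with it [l_a u_a]. *)
Lemma psd_ker d (U : 'M[C]_d) (l : 'I_d -> R) (v : 'cV[C]_d) :
  (forall a, 0 <= l a) -> (adj v *m udu U l *m v) 0 0 = 0 -> udu U l *m v = 0.
Proof.
move=> l0; rewrite /udu !mulmxA -(mulmxA _ (adj U)) -(mulmxA _ (adj U) v).
set u := adj U *m v; have -> : adj v *m U = adj u by rewrite /u adjM adjK.
clearbody u; rewrite mxE => h0.
have ha a : (l a)%:C * (u a 0 * conjc (u a 0)) = 0.
  have e : \sum_j (l j)%:C * (u j 0 * conjc (u j 0)) = 0.
    rewrite -[RHS]h0; apply: eq_bigr => j _; rewrite mul_mx_diag mxE adjE mxE.
    by rewrite mulrAC [RHS]mulrC (mulrC (u j 0)).
  by apply: (psumr_eq0P _ e) => // j _; rewrite mulr_ge0 ?ler0c ?mulcJ_ge0.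
rewrite -mulmxA (_ : diag_mx _ *m u = 0) ?mulmx0 //.
apply/matrixP => a j; rewrite mul_diag_mx !mxE ord1.
have /eqP := ha a; rewrite !mulf_eq0 conjc_eq0 => /orP[/eqP->|]; first by rewrite mul0r.
by case/orP => /eqP ->; rewrite mulr0.
Qed.

Lemma lg_sqr_bound n (F : 'I_n -> R) (D : R) (K : R) : (0 < n)%N -> 0 < D ->
  \sum_i F i <= n%:R * K -> (\sum_i F i) / (n%:R * D) ^+ 2 <= K / (n%:R * D ^+ 2).
Proof.
move=> n0 D0 h; have nR : 0 < n%:R :> R by rewrite ltr0n.
rewrite ler_pdivrMr ?exprn_gt0 ?mulr_gt0 //; apply: le_trans h _.
by rewrite exprMn le_eqVlt; apply/orP; left; apply/eqP; field; rewrite !gt_eqF.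
Qed.

Lemma prod_tail_high d n (w : 'I_n -> 'I_d -> R) (D : R) : (0 < n)%N -> 0 < D ->
  (forall i a, 0 <= w i a) -> (forall i, \sum_a w i a = 1) ->
  \sum_(b : 'I_(d ^ n)) (\prod_i w i (dec b i)) *
    (2 `^ (\sum_i negent (w i) + n%:R * D) < \prod_i w i (dec b i))%R%:R <=
  d%:R * lgsq_max R / (n%:R * D ^+ 2).
Proof.
move=> n0 D0 w0 w1; have nR : 0 < n%:R :> R by rewrite ltr0n.
have nD : 0 < n%:R * D by rewrite mulr_gt0.
have [h _] := prod_typical nD w0 w1 w0 (fun i a e => e).
rewrite sum_dec in h; apply: le_trans h _; apply: lg_sqr_bound => //.
have -> : n%:R * (d%:R * lgsq_max R) = \sum_(i < n) d%:R * lgsq_max R.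
  by rewrite sumr_const card_ord mulr_natl.
by apply: ler_sum => i _; apply: sum_lg_sqr_le.
Qed.

Lemma sum_ffun_pair (I A B : finType) (F : {ffun I -> A} -> {ffun I -> B} -> R) :
  \sum_(g : {ffun I -> A}) \sum_(h : {ffun I -> B}) F g h =
  \sum_(f : {ffun I -> A * B}) F [ffun i => (f i).1] [ffun i => (f i).2].
Proof.
rewrite pair_big /= (reindex (fun f : {ffun I -> A * B} =>
  ([ffun i => (f i).1], [ffun i => (f i).2]))) //=.
apply: onW_bij.
exists (fun gh : {ffun I -> A} * {ffun I -> B} => [ffun i => (gh.1 i, gh.2 i)]).
  by move=> f; apply/ffunP => i; rewrite !ffunE /=; case: (f i).
by case=> g h; congr (_, _); apply/ffunP => i; rewrite !ffunE.
Qed.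

Section Channel.
Variables (X : finType) (d : nat) (W : X -> 'M[C]_d).
Variables (U : X -> 'M[C]_d) (l : X -> 'I_d -> R).
Hypothesis hU : forall x, U x *m adj (U x) = 1%:M.
Hypothesis l0 : forall x a, 0 <= l x a.
Hypothesis l1 : forall x, \sum_a l x a = 1.
Hypothesis eW : forall x, W x = udu (U x) (l x).

(** Law of the outcome when [W x] is measured in the basis of columns of a unitary [V]. *)
Definition outp (V : 'M[C]_d) (x : X) (b : 'I_d) : R :=
  Re ((adj V *m W x *m V) b b).

Lemma W_density x : density (W x).
Proof. by rewrite eW; apply: udu_density. Qed.

Lemma outpE V x b : (adj V *m W x *m V) b b = (outp V x b)%:C.
Proof.
by apply: herm_diag_real; rewrite !adjM adjK eW udu_adj mulmxA.
Qed.

Lemma outp_ge0 V x b : 0 <= outp V x b.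
Proof.
have [h _] := W_density x; have := h (col b V); rewrite -quad_colE outpE.
by rewrite ler0c.
Qed.

Lemma outp_sum V x : V *m adj V = 1%:M -> \sum_b outp V x b = 1.
Proof. by move=> hV; rewrite sum_diag_rtr // eW rtr_udu. Qed.

Lemma outp_mix V (p : X -> R) s b : V *m adj V = 1%:M ->
  \sum_x (p x)%:C *: W x = udu V s -> \sum_x p x * outp V x b = s b.
Proof.
move=> hV e; have := udu_quad s b hV; rewrite -e mulmx_sumr mulmx_suml summxE.
move=> /(congr1 Re); rewrite Re_sum /= => <-; apply: eq_bigr => x _.
by rewrite -scalemxAr -scalemxAl mxE Re_realM.
Qed.

Lemma outp_supp V (p : X -> R) s b x : V *m adj V = 1%:M ->
  (forall x, 0 <= p x) -> \sum_x (p x)%:C *: W x = udu V s ->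
  0 < p x -> s b = 0 -> outp V x b = 0.
Proof.
move=> hV p0 e px sb; have := outp_mix b hV e; rewrite sb => h.
have /eqP : p x * outp V x b = 0.
  by apply: (psumr_eq0P _ h) => // y _; rewrite mulr_ge0 // outp_ge0.
by rewrite mulf_eq0 gt_eqF //= => /eqP.
Qed.

Lemma relent_udu (V : 'M[C]_d) s x : V *m adj V = 1%:M ->
  (forall v : 'cV[C]_d, udu V s *m v = 0 -> W x *m v = 0) ->
  relent (W x) (udu V s) = (negent (l x) - \sum_b outp V x b * lg (s b))%:E.
Proof.
move=> hV hs; rewrite /relent asboolT //; congr (_%:E).
rewrite mulmxBr -/(rtr _) rtrB /mlog hfun_udu // {1 2}eW hfun_udu // udu_mul //.
rewrite rtr_udu // -/(lg) rtr_mul_udu; congr (_ - _).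
by apply: eq_bigr => b _; rewrite mulrC.
Qed.

(** Output entropy minus mean conditional entropy: the outcome laws [outp V x] average to [s], which
    turns the cross term into [negent s]. *)
Lemma mutinf_udu (p : {ffun X -> R}) (V : 'M[C]_d) s : prob p ->
  V *m adj V = 1%:M -> avg W p = udu V s ->
  mutinf W p = (\sum_x p x * negent (l x) - negent s)%:E.
Proof.
move=> [p0 p1] hV e; rewrite /mutinf e.
rewrite (eq_bigr (fun x => (p x * (negent (l x) - \sum_b outp V x b * lg (s b)))%:E)).
  rewrite sumEFin; congr (_%:E).
  under eq_bigr do rewrite mulrBr; rewrite sumrB; congr (_ - _).
  under eq_bigr do rewrite mulr_sumr; rewrite exchange_big /=.
  apply: eq_bigr => b _; rewrite -(outp_mix b hV e) mulr_suml.
  by apply: eq_bigr => x _; rewrite mulrA.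
(* A letter of zero probability contributes 0 even when its relative entropy is infinite. *)
move=> x _; have := p0 x; rewrite le_eqVlt => /predU1P[<-|px].
  by rewrite mul0e mul0r.
rewrite relent_udu // => v hv.
(* Support condition for [p x > 0]: on the kernel of the average every nonnegative term of the
   quadratic form vanishes, and [psd_ker] concludes for [W x]. *)
have qge y : 0 <= (p y)%:C * (adj v *m W y *m v) 0 0.
  by rewrite mulr_ge0 ?ler0c //; have [h _] := W_density y; exact: h.
have hq : \sum_y (p y)%:C * (adj v *m W y *m v) 0 0 = 0.
  transitivity ((adj v *m (avg W p *m v)) 0 0).
    rewrite mulmxA /avg mulmx_sumr mulmx_suml summxE; apply: eq_bigr => y _.
    by rewrite -scalemxAr -scalemxAl [RHS]mxE.
  by rewrite e hv mulmx0 mxE.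
have /eqP : (p x)%:C * (adj v *m W x *m v) 0 0 = 0 by apply: (psumr_eq0P _ hq).
rewrite mulf_eq0 => /orP[/eqP[] h|/eqP h]; first by rewrite h ltxx in px.
by rewrite eW; apply: psd_ker => //; rewrite -eW.
Qed.

Definition Un n (xn : {ffun 'I_n -> X}) : 'M[C]_(d ^ n) :=
  tens_fam (fun i => U (xn i)).
Definition lprod n (xn : {ffun 'I_n -> X}) (b : 'I_(d ^ n)) : R :=
  \prod_i l (xn i) (dec b i).

Lemma Un_unitary n (xn : {ffun 'I_n -> X}) : Un xn *m adj (Un xn) = 1%:M.
Proof. exact: tens_unitary. Qed.

Lemma WnE n (xn : {ffun 'I_n -> X}) : Wn W xn = udu (Un xn) (lprod xn).
Proof.
transitivity (tens_fam (fun i => udu (U (xn i)) (l (xn i)))).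
  by congr tens_fam; apply: funext => i; rewrite eW.
exact: (tens_udu (fun i => U (xn i)) (fun i => l (xn i))).
Qed.

Lemma lprod_ge0 n (xn : {ffun 'I_n -> X}) b : 0 <= lprod xn b.
Proof. by apply: prodr_ge0. Qed.

Lemma lprod_sum n (xn : {ffun 'I_n -> X}) : \sum_b lprod xn b = 1.
Proof.
rewrite -(sum_dec (fun f => \prod_i l (xn i) (f i))).
exact: (sum_prod_dist (fun i => l1 (xn i))).
Qed.

(** Letter and eigenvalue index are drawn jointly with law [p x * l x a], and [prod_typical] is
    applied with the conditional eigenvalue [l x a] as weight. *)
Lemma mix_tail_low n (p : X -> R) (D : R) : (0 < n)%N -> 0 < D ->
  (forall x, 0 <= p x) -> \sum_x p x = 1 ->
  \sum_(xn : {ffun 'I_n -> X}) (\prod_i p (xn i)) *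
    small_mass (lprod xn) (2 `^ (n%:R * (\sum_x p x * negent (l x) - D))) <=
  d%:R * lgsq_max R / (n%:R * D ^+ 2).
Proof.
move=> n0 D0 p0 p1; have nR : 0 < n%:R :> R by rewrite ltr0n.
have nD : 0 < n%:R * D by rewrite mulr_gt0.
pose v (i : 'I_n) (xa : X * 'I_d) := p xa.1 * l xa.1 xa.2.
pose w (i : 'I_n) (xa : X * 'I_d) := l xa.1 xa.2.
have sumv (F : X -> 'I_d -> R) i :
    \sum_xa v i xa * F xa.1 xa.2 = \sum_x p x * \sum_a l x a * F x a.
  transitivity (\sum_x \sum_a p x * l x a * F x a); first by rewrite pair_bigA.
  apply: eq_bigr => x _; rewrite mulr_sumr.
  by apply: eq_bigr => a _; rewrite mulrA.
have v1 i : \sum_xa v i xa = 1.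
  have := sumv (fun _ _ => 1) i; under eq_bigr do rewrite mulr1; move=> ->.
  rewrite -[RHS]p1; apply: eq_bigr => x _; under eq_bigr do rewrite mulr1.
  by rewrite l1 mulr1.
have wv i xa : w i xa = 0 -> v i xa = 0 by rewrite /v /w => ->; rewrite mulr0.
have [_ h] := @prod_typical R _ _ v w _ nD (fun i xa => mulr_ge0 (p0 _) (l0 _ _)) v1
   (fun i xa => l0 _ _) wv.
apply: (le_trans _ (le_trans h _)).
  rewrite le_eqVlt; apply/orP; left; apply/eqP.
  pose F (g : {ffun 'I_n -> X}) (k : {ffun 'I_n -> 'I_d}) := (\prod_i p (g i)) *
    ((\prod_i l (g i) (k i)) * (\prod_i l (g i) (k i) <
       2 `^ (n%:R * (\sum_x p x * negent (l x) - D)))%R%:R).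
  transitivity (\sum_g \sum_k F g k).
    apply: eq_bigr => g _; rewrite /F sum_dec /small_mass mulr_sumr.
    by apply: eq_bigr => b _.
  rewrite sum_ffun_pair; apply: eq_bigr => f _; rewrite /F /v /w mulrA.
  rewrite big_split /=; congr (_ * _ * _).
  + by apply: eq_bigr => i _; rewrite ffunE.
  + by apply: eq_bigr => i _; rewrite !ffunE.
  + congr (nat_of_bool (_ < _)%R)%:R; first by apply: eq_bigr => i _; rewrite !ffunE.
    congr (_ `^ _); under [in RHS]eq_bigr => i _ do
      rewrite (sumv (fun x a => lg (l x a)) i).
    by rewrite mulrBr; congr (_ - _); rewrite sumr_const card_ord mulr_natl.
apply: lg_sqr_bound => //.
have -> : n%:R * (d%:R * lgsq_max R) = \sum_(i < n) d%:R * lgsq_max R.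
  by rewrite sumr_const card_ord mulr_natl.
apply: ler_sum => i _; rewrite (sumv (fun x a => lg (l x a) ^+ 2) i).
set K := d%:R * lgsq_max R; rewrite -[leRHS]mul1r -p1 mulr_suml; apply: ler_sum => x _.
by rewrite ler_wpM2l // sum_lg_sqr_le.
Qed.

(** Measured in the product eigenbasis of the average state of its own type, the output of [xn]
    gives independent outcomes. Their laws vary with the position but sum to [n s], so the mean
    logarithm is exactly [n * negent s]. *)
Lemma out_tail_low n (xn : {ffun 'I_n -> X}) (V : 'M[C]_d) (s : 'I_d -> R) (D : R) :
  (0 < n)%N -> 0 < D -> V *m adj V = 1%:M -> (forall b, 0 <= s b) ->
  \sum_b s b = 1 -> \sum_x (emp R xn x)%:C *: W x = udu V s ->
  rtr ((1%:M - udu (tens_fam (fun _ : 'I_n => V)) (fun b => (2 `^ (n%:R * (negent s - D)) <=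
                                 \prod_(i < n) s (dec b i))%R%:R))
       *m udu (Un xn) (lprod xn)) <= d%:R * lgsq_max R / (n%:R * D ^+ 2).
Proof.
move=> n0 D0 hV s0 s1 es; set Vn := tens_fam (fun _ : 'I_n => V).
have hVn : Vn *m adj Vn = 1%:M by apply: tens_unitary.
have nR : 0 < n%:R :> R by rewrite ltr0n.
have nD : 0 < n%:R * D by rewrite mulr_gt0.
have [q0 q1] := (emp_probM R xn n0).1.
pose v (i : 'I_n) b := outp V (xn i) b.
have sumv b : \sum_i v i b = n%:R * s b.
  rewrite -(outp_mix b hV es) emp_sumr mulrC divfK ?gt_eqF //.
have vs i b : s b = 0 -> v i b = 0.
  move=> sb; apply: (outp_supp hV q0 es) => //.
  rewrite ffunE divr_gt0 // (bigD1 i) //= eqxx.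
  by rewrite ltr_pwDl // sumr_ge0.
have mE : \sum_i \sum_b v i b * lg (s b) = n%:R * negent s.
  rewrite exchange_big mulr_sumr /=; apply: eq_bigr => b _.
  by rewrite -mulr_suml sumv mulrA.
have [_ h] := prod_typical nD (fun i b => outp_ge0 V (xn i) b)
  (fun i => outp_sum (xn i) hV) (fun _ b => s0 b) vs.
rewrite mE -mulrBr sum_dec in h.
have -> : 1%:M - udu Vn (fun b => (2 `^ (n%:R * (negent s - D)) <=
                                 \prod_(i < n) s (dec b i))%R%:R) =
   udu Vn (fun b => (\prod_(i < n) s (dec b i) < 2 `^ (n%:R * (negent s - D)))%R%:R).
  rewrite -(udu1 hVn) udu_opp udu_add; apply: eq_udu => b.
  by rewrite ltNge; case: (_ <= _)%R; rewrite /= ?subrr ?subr0.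
rewrite rtrC rtr_mul_udu; apply: (le_trans _ (le_trans h _)).
  rewrite le_eqVlt; apply/orP; left; apply/eqP; apply: eq_bigr => b _.
  rewrite mulrC; congr (_ * _).
  have -> : adj Vn *m udu (Un xn) (lprod xn) *m Vn =
      tens_fam (fun i : 'I_n => adj V *m W (xn i) *m V).
    by rewrite -WnE /Vn tens_adj /Wn !tens_mul.
  by apply: (tens_diag_entry (r := fun i a => outp V (xn i) a)) => i a; exact: outpE.
apply: lg_sqr_bound => //; rewrite exchange_big /=.
under eq_bigr => b _ do rewrite -mulr_suml sumv -mulrA.
by rewrite -mulr_sumr ler_pM2l // sum_lg_sqr_le.
Qed.

End Channel.
End Entropy.

(** * Achievability and strong converse at large block length *)

Section Asymptotics.
Local Open Scope complex_scope.
Variable R : realType.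
Local Notation C := (R[i]).

Variables (X : finType) (d : nat) (W : X -> 'M[C]_d).
Variables (U : X -> 'M[C]_d) (l : X -> 'I_d -> R).
Hypothesis hU : forall x, U x *m adj (U x) = 1%:M.
Hypothesis l0 : forall x a, 0 <= l x a.
Hypothesis l1 : forall x, \sum_a l x a = 1.
Hypothesis eW : forall x, W x = udu (U x) (l x).

Lemma avgn_udu n (pn : {ffun {ffun 'I_n -> X} -> R}) :
  avgn W pn = \sum_xn (pn xn)%:C *: udu (Un U xn) (lprod l xn).
Proof. by apply: eq_bigr => xn _; rewrite (WnE eW). Qed.

Lemma avgn_density n (pn : {ffun {ffun 'I_n -> X} -> R}) : prob pn ->
  density (avgn W pn).
Proof.
move=> [p0 p1]; rewrite avgn_udu; apply: density_mix => // xn.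
apply: udu_density; [exact: Un_unitary | move=> b; exact: lprod_ge0 |].
exact: lprod_sum.
Qed.

Lemma avgn_diff_herm n (pn qn : {ffun {ffun 'I_n -> X} -> R}) :
  adj (avgn W pn - avgn W qn) = avgn W pn - avgn W qn.
Proof.
rewrite adjB !avgn_udu !adj_sum; congr (_ - _); apply: eq_bigr => xn _;
  by rewrite adjZ udu_adj.
Qed.

Lemma avgn_dist_le1 n (pn qn : {ffun {ffun 'I_n -> X} -> R}) :
  prob pn -> prob qn -> trnorm (avgn W pn - avgn W qn) / 2 <= 1.
Proof.
move=> hp hq; have [S [hS SS ->]] := trnorm_attained (avgn_diff_herm pn qn).
have SS' : S *m adj S = 1%:M by rewrite hS.
have h rn : prob rn -> `|rtr (avgn W rn *m S)| <= 1.
  move=> /avgn_density/density_spec[V [s [hV -> s0 <-]]].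
  exact: rtr_hunitary_udu_le.
have := h _ hp; have := h _ hq; rewrite !ler_norml => /andP[h1 h2] /andP[h3 h4].
rewrite mulmxBl rtrB; lra.
Qed.

Lemma res_err_le n M (e : R) : 0 <= e ->
  (forall pn : {ffun {ffun 'I_n -> X} -> R}, prob pn -> exists2 qn, probM M qn &
     trnorm (avgn W pn - avgn W qn) / 2 <= e) ->
  res_err W n M <= e.
Proof.
move=> e0 h; rewrite /res_err; set S := (X in sup X).
(* With no input law at all, the supremum of the empty set is 0 by convention. *)
have [->|/set0P S0] := eqVneq S set0; first by rewrite sup0.
apply: ge_sup => // _ [pn hp <-]; have [qn hq hle] := h pn hp.
apply: le_trans hle; apply: ge_inf; last by exists qn.
by exists 0 => _ [q _ <-]; rewrite divr_ge0 // trnorm_ge0 // avgn_diff_herm.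
Qed.

Lemma res_err_ge n M (e : R) (pn : {ffun {ffun 'I_n -> X} -> R}) :
  (0 < M)%N -> prob pn ->
  (forall qn, probM M qn -> e <= trnorm (avgn W pn - avgn W qn) / 2) ->
  e <= res_err W n M.
Proof.
move=> M0 hp h.
have [x0 _] : exists x0 : {ffun 'I_n -> X}, True.
  case: (pickP {ffun 'I_n -> X}) => [x0 _|hx]; first by exists x0.
  by case: hp => _; rewrite big_pred0 // => /esym/eqP; rewrite oner_eq0.
(* A constant codebook makes the inner set nonempty and bounds every infimum by 1, so that the outer
   set has an upper bound. *)
pose q0 := emp R [ffun _ : 'I_M => x0]; have hq0 : probM M q0 := emp_probM R _ M0.
apply: (@le_trans _ _ (inf [set trnorm (avgn W pn - avgn W qn) / 2 | qn in
    @probM R {ffun 'I_n -> X} M]%classic)).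
  apply: lb_le_inf; first by exists (trnorm (avgn W pn - avgn W q0) / 2); exists q0.
  by move=> _ [qn hq <-]; exact: h.
apply: ub_le_sup; last by exists pn.
exists 1 => _ [p' hp' <-].
apply: (@le_trans _ _ (trnorm (avgn W p' - avgn W q0) / 2)).
  apply: ge_inf; last by exists q0.
  by exists 0 => _ [q _ <-]; rewrite divr_ge0 // trnorm_ge0 // avgn_diff_herm.
by apply: avgn_dist_le1 => //; case: hq0.
Qed.

Lemma res_err_ge0 n M : (0 < #|X|)%N -> (0 < M)%N -> 0 <= res_err W n M.
Proof.
move=> /card_gt0P[x _] M0.
pose pn := emp R [ffun _ : 'I_1 => [ffun _ : 'I_n => x]].
apply: (@res_err_ge _ _ _ pn) => //; first by case: (emp_probM R [ffun _ : 'I_1 => [ffun _ : 'I_n => x]] isT).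
by move=> q _; rewrite divr_ge0 // trnorm_ge0 // avgn_diff_herm.
Qed.

(** The classes are the types, at most [(n+1)^|X|] many. For type [P] the projection comes from the
    output state of [P] and the cut from its conditional entropy, so trace times cut is at most
    [2^(n (I(P) + 2D))]. *)
Lemma covering_n n M (c D gam kap : R) (pn : {ffun {ffun 'I_n -> X} -> R}) :
  (forall p : {ffun X -> R}, prob p -> (mutinf W p <= c%:E)%E) ->
  (0 < n)%N -> (0 < M)%N -> 0 < D -> 0 < gam -> 0 < kap -> prob pn ->
  exists2 qn, probM M qn & trnorm (avgn W pn - avgn W qn) / 2 <=
    d%:R * lgsq_max R / (n%:R * D ^+ 2) +
      (kap + d%:R * lgsq_max R / (n%:R * D ^+ 2) / kap) +
    (n.+1%:R ^+ #|X| * gam + 2 `^ (n%:R * (c + 2 * D)) / (gam * M%:R)).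
Proof.
move=> hc n0 M0 D0 g0 k0 [pn0 pn1].
have nR : 0 < n%:R :> R by rewrite ltr0n.
pose cnt (xn : {ffun 'I_n -> X}) x := (\sum_i (xn i == x))%N.
pose typ (xn : {ffun 'I_n -> X}) : {ffun X -> 'I_n.+1} :=
  [ffun x => inord (cnt xn x)].
pose Pk (k : {ffun X -> 'I_n.+1}) x : R := (k x)%:R / n%:R.
have PkE xn : Pk (typ xn) =1 emp R xn.
  move=> x; rewrite /Pk !ffunE inordK ?natr_sum //.
  rewrite ltnS /cnt; apply: (@leq_trans (\sum_(i < n) 1)%N).
    by apply: leq_sum => i _; case: eqP.
  by rewrite sum_nat_const card_ord muln1.
(* A count vector [k] need not sum to [n], so only hermiticity is used here; [sden] adds positivity
   and trace 1 for types that occur. *)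
have /choice[Vs hVs] (k : {ffun X -> 'I_n.+1}) : exists Vs : 'M[C]_d * ('I_d -> R),
    Vs.1 *m adj Vs.1 = 1%:M /\ \sum_x (Pk k x)%:C *: W x = udu Vs.1 Vs.2.
  have [|V [s [hV es]]] := @herm_spec R d (\sum_x (Pk k x)%:C *: W x).
    by rewrite adj_sum; apply: eq_bigr => x _; rewrite adjZ eW udu_adj.
  by exists (V, s).
pose Hs k := negent (Vs k).2; pose Hc k := \sum_x Pk k x * negent (l x).
pose Pi k := udu (tens_fam (fun _ : 'I_n => (Vs k).1))
  (fun b => (2 `^ (n%:R * (Hs k - D)) <= \prod_(i < n) (Vs k).2 (dec b i))%R%:R).
have empk xn : \sum_x (emp R xn x)%:C *: W x = udu (Vs (typ xn)).1 (Vs (typ xn)).2.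
  by rewrite -(hVs _).2; apply: eq_bigr => x _; rewrite PkE.
have sden xn : (forall b, 0 <= (Vs (typ xn)).2 b) /\ \sum_b (Vs (typ xn)).2 b = 1.
  have [[q0 q1] _] := emp_probM R xn n0.
  have hV := (hVs (typ xn)).1.
  have [h1 h2] := density_mix (W_density hU l0 l1 eW) q0 q1.
  rewrite empk in h1 h2; split; first exact: psd_udu_ge0 h1.
  by rewrite -(rtr_udu _ hV) /rtr h2.
have Hcemp xn : Hc (typ xn) = \sum_x emp R xn x * negent (l x).
  by apply: eq_bigr => x _; rewrite PkE.
have HcE xn : n%:R * Hc (typ xn) = \sum_i negent (l (xn i)).
  by rewrite Hcemp emp_sumr mulrC divfK // gt_eqF.
(* The type of a word is itself an input law, so [hc] applies to it. *)
have Ile xn : Hc (typ xn) - Hs (typ xn) <= c.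
  have [hp _] := emp_probM R xn n0; have := hc _ hp.
  rewrite (mutinf_udu hU l0 l1 eW hp (hVs (typ xn)).1 (empk xn)) lee_fin.
  by rewrite Hcemp.
have hPi k : proj (Pi k).
  apply: (proj_udu (fun b => (2 `^ (n%:R * (Hs k - D)) <=
                              \prod_(i < n) (Vs k).2 (dec b i))%R)).
  by apply: tens_unitary => _; exact: (hVs k).1.
have hr xn : rtr (Pi (typ xn)) <= 2 `^ (- (n%:R * (Hs (typ xn) - D))).
  have [s0 s1] := sden xn.
  rewrite rtr_udu; last by apply: tens_unitary => _; exact: (hVs _).1.
  rewrite pow2N; apply: sum_threshold_le; first exact: pow2_gt0.
    by move=> b; apply: prodr_ge0.
  rewrite -(sum_dec (fun f : {ffun 'I_n -> 'I_d} => \prod_i (Vs (typ xn)).2 (f i))).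
  exact: (sum_prod_dist (fun _ : 'I_n => s1)).
have htail xn : \sum_b lprod l xn b *
    (2 `^ (n%:R * (Hc (typ xn) + D)) < lprod l xn b)%R%:R <=
    d%:R * lgsq_max R / (n%:R * D ^+ 2).
  by rewrite mulrDr HcE; apply: prod_tail_high.
have hout xn : rtr ((1%:M - Pi (typ xn)) *m udu (Un U xn) (lprod l xn)) <=
    d%:R * lgsq_max R / (n%:R * D ^+ 2).
  have [s0 s1] := sden xn.
  exact: (out_tail_low hU l0 l1 eW n0 D0 (hVs (typ xn)).1 s0 s1 (empk xn)).
have hG xn : 2 `^ (- (n%:R * (Hs (typ xn) - D))) * 2 `^ (n%:R * (Hc (typ xn) + D)) <=
    2 `^ (n%:R * (c + 2 * D)).
  rewrite -pow2D ler_pow2 -mulrN -mulrDr ler_pM2l //; have := Ile xn; lra.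
have [f hf] := @oneshot_covering R {ffun 'I_n -> X} {ffun X -> 'I_n.+1} typ (d ^ n)
  (Un U (n := n)) (lprod l (n := n)) Pi
  (fun k => 2 `^ (- (n%:R * (Hs k - D)))) (fun k => 2 `^ (n%:R * (Hc k + D)))
  (d%:R * lgsq_max R / (n%:R * D ^+ 2)) (2 `^ (n%:R * (c + 2 * D))) gam kap M pn
  (Un_unitary hU (n := n)) (fun xn b => lprod_ge0 l0 xn b)
  (fun xn => lprod_sum l1 xn) hPi
  (fun k => pow2_gt0 _) (fun k => pow2_ge0 _) hr htail hout hG pn0 pn1 M0 g0 k0.
exists (emp R f); first exact: emp_probM.
by rewrite !avgn_udu; move: hf; rewrite card_ffun card_ord natrX.
Qed.

Lemma achievability (c D e : R) :
  (forall p : {ffun X -> R}, prob p -> (mutinf W p <= c%:E)%E) -> 0 < D -> 0 < e ->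
  exists n0 : nat, forall n, (n0 <= n)%N -> forall M, (0 < M)%N ->
    2 `^ (n%:R * (c + 4 * D)) <= 2 * M%:R -> res_err W n M <= e.
Proof.
(* The bound of [covering_n] has five terms, each made at most [k], within [e = 8 k]. *)
move=> hc D0 e0; pose A := d%:R * lgsq_max R / D ^+ 2; pose k := e / 8.
have k0 : 0 < k by rewrite divr_gt0.
have [n1 h1] := div_nat_small A k0.
have [n2 h2] := div_nat_small A (mulr_gt0 k0 k0).
have [n3 h3] := poly_pow2_small #|X| D0 k0.
have [n4 h4] := poly_pow2_small 0 D0 (divr_gt0 k0 (ltr0n R 2)).
exists (maxn (maxn n1 n2) (maxn n3 n4)) => n.
rewrite !geq_max => /andP[/andP[g1 g2] /andP[g3 g4]] M M0 hM.
have {h1}[n0 h1] := h1 _ g1; have {h2}[_ h2] := h2 _ g2.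
have {}h3 := h3 _ g3; have {}h4 := h4 _ g4.
have nR : 0 < n%:R :> R by rewrite ltr0n.
have MR : 0 < M%:R :> R by rewrite ltr0n.
apply: res_err_le => [|pn hp]; first exact: ltW.
(* The share [gam = 2^(-nD)] beats the polynomial number of types; the surplus [2D] of the rate over
   [c + 2D] pays for [1 / gam] and leaves a decay [2^(-nD)]. *)
have [qn hq hle] := covering_n hc n0 M0 D0 (pow2_gt0 (- (n%:R * D))) k0 hp.
exists qn => //; apply: (le_trans hle).
have -> : d%:R * lgsq_max R / (n%:R * D ^+ 2) = A / n%:R.
  by rewrite /A invfM [_^-1 * _]mulrC mulrA.
have h5 : A / n%:R / k <= k by rewrite ler_pdivrMr.
have h6 : 2 `^ (n%:R * (c + 2 * D)) / (2 `^ (- (n%:R * D)) * M%:R) <=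
    2 * 2 `^ (- (n%:R * D)).
  rewrite ler_pdivrMr ?mulr_gt0 ?pow2_gt0 //.
  apply: (@le_trans _ _ (2 `^ (- (n%:R * D) - n%:R * D) * 2 `^ (n%:R * (c + 4 * D)))).
    by rewrite -pow2D ler_pow2; lra.
  set g := 2 `^ (- (n%:R * D)).
  have -> : 2 * g * (g * M%:R) = g * g * (2 * M%:R) by ring.
  by rewrite pow2D ler_pM2l // mulr_gt0 // pow2_gt0.
rewrite expr0 mul1r in h4.
have ek : e = 8 * k by rewrite /k; field.
rewrite ek; lra.
Qed.

Lemma strong_converse (p : {ffun X -> R}) (V : 'M[C]_d) (s : 'I_d -> R) (r e : R) :
  prob p -> V *m adj V = 1%:M -> avg W p = udu V s -> 0 <= r ->
  r < \sum_x p x * negent (l x) - negent s -> e < 1 ->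
  exists n0 : nat, forall n, (n0 <= n)%N -> forall M, (0 < M)%N ->
    M%:R <= 2 `^ (n%:R * r) -> e <= res_err W n M.
Proof.
move=> [p0 p1] hV es r0 hr e1.
have [sp st] := density_mix (W_density hU l0 l1 eW) p0 p1.
have s0 : forall b, 0 <= s b by apply: (psd_udu_ge0 hV); rewrite -es.
have s1 : \sum_b s b = 1 by rewrite -(rtr_udu _ hV) -es /rtr st.
pose Hc := \sum_x p x * negent (l x); pose Hs := negent s.
(* The gap to the mutual information is cut into eight shares: [N * L * tau] spends five and keeps a
   decay [2^(-3na)]. *)
pose a := (Hc - Hs - r) / 8; have a0 : 0 < a by rewrite divr_gt0 // subr_gt0.
have ea : Hc - Hs = r + 8 * a by rewrite /a; field.
(* Here [1 = e + 2 eta]: one [eta] is the weight required on the projection, the other absorbs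
   [N * L * tau]. *)
pose eta := (1 - e) / 2; have eta0 : 0 < eta by rewrite divr_gt0 // subr_gt0.
pose A := d%:R * lgsq_max R / a ^+ 2.
(* A quarter of the mean allowed by Chernoff's hypothesis; each of the three contributions will be
   at most [b0]. *)
pose b0 := eta / 2 / expR (2 / eta) / 4.
have b0p : 0 < b0 by rewrite divr_gt0 // divr_gt0 ?expR_gt0 // divr_gt0.
have [n1 h1] := div_nat_small A b0p.
have [n2 h2] := poly_pow2_small 0 a0 b0p.
have a3 : 0 < 3 * a by rewrite mulr_gt0.
have [n3 h3] := poly_pow2_small 0 a3 (divr_gt0 eta0 (ltr0n R 2)).
have a2 : 0 < 2 * a by rewrite mulr_gt0.
(* Ensures [2 (|X|+1)(n+1) <= 2^(2na)], so that [N] exceeds [2 |X| n M] in the union bound. *)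
pose q : R := (2 * #|X|.+1%:R)^-1.
have q0 : 0 < q by rewrite invr_gt0 mulr_gt0 // ltr0n.
have [n4 h4] := poly_pow2_small 1 a2 q0.
exists (maxn (maxn n1 n2) (maxn n3 n4)) => n.
rewrite !geq_max => /andP[/andP[g1 g2] /andP[g3 g4]] M M0 hM.
have {h1}[n0 h1] := h1 _ g1; have {}h2 := h2 _ g2.
have {}h3 := h3 _ g3; have {}h4 := h4 _ g4.
rewrite expr0 mul1r in h2; rewrite expr0 mul1r in h3; rewrite expr1 in h4.
have nR : 0 < n%:R :> R by rewrite ltr0n.
have MR : 0 < M%:R :> R by rewrite ltr0n.
pose z := 2 `^ (n%:R * (r + 2 * a)) : R.
have z1 : 1 <= z.
  rewrite -(powRr0 2) /z ler_pow2 mulr_ge0 // ?addr_ge0 // ltW //.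
pose N := (Num.truncn z).+1.
have Nz : z < N%:R by exact: truncnS_gt.
have Nz2 : N%:R <= 2 * z.
  rewrite /N -natr1; have : (Num.truncn z)%:R <= z by rewrite truncn_le; lra.
  lra.
(* [Hc] and [Hs] are negated entropies: [L] is [2^(n (H(B|X) + a))], [1 / tau] is
   [2^(n (H(B) - 2a))], and [t] lies just above the typical eigenvalues [2^(-n H(B))]. *)
pose L := 2 `^ (- (n%:R * (Hc - a))) : R.
pose tau := 2 `^ (n%:R * (Hs + 2 * a)) : R.
pose t := 2 `^ (n%:R * (Hs + a)) : R.
have dn : d%:R * lgsq_max R / (n%:R * a ^+ 2) = A / n%:R.
  by rewrite /A invfM [_^-1 * _]mulrC mulrA.
pose pn : {ffun {ffun 'I_n -> X} -> R} := 
  [ffun xn : {ffun 'I_n -> X} => \prod_i p (xn i)].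
have pn0 xn : 0 <= pn xn by rewrite ffunE; apply: prodr_ge0.
have pn1 : \sum_xn pn xn = 1.
  rewrite -[RHS](sum_prod_dist (fun _ : 'I_n => p1)).
  by apply: eq_bigr => xn _; rewrite ffunE.
have esig : \sum_xn (pn xn)%:C *: udu (Un U xn) (lprod l xn) =
    udu (tens_fam (fun _ : 'I_n => V)) (fun b => \prod_(i < n) s (dec b i)).
  by rewrite -avgn_udu avgn_prod es (tens_udu (fun=> V) (fun=> s)).
have hVn : tens_fam (fun _ : 'I_n => V) *m adj (tens_fam (fun _ : 'I_n => V)) = 1%:M.
  exact: tens_unitary.
have m1 : \sum_(b < d ^ n) (\prod_(i < n) s (dec b i)) *
    (t < \prod_(i < n) s (dec b i))%R%:R <= b0.
  have := @prod_tail_high R d n (fun=> s) a n0 a0 (fun=> s0) (fun=> s1).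
  have -> : \sum_(i < n) negent s + n%:R * a = n%:R * (Hs + a).
    by rewrite mulrDr; congr (_ + _); rewrite sumr_const card_ord mulr_natl.
  rewrite dn => h.
  exact: le_trans h h1.
have m2 : \sum_xn pn xn * small_mass (lprod l xn) L^-1 <= b0.
  have := @mix_tail_low R X d l l0 l1 n p a n0 a0 p0 p1; rewrite dn => h.
  apply: le_trans (le_trans h h1); rewrite /L -pow2N opprK.
  by rewrite le_eqVlt; apply/orP; left; apply/eqP; apply: eq_bigr => xn _; rewrite ffunE.
have m3 : t / tau <= b0.
  by rewrite /t /tau -pow2N -pow2D; apply: le_trans h2; rewrite ler_pow2; lra.
have hmu : (t / tau + \sum_(b < d ^ n) (\prod_(i < n) s (dec b i)) *
    (t < \prod_(i < n) s (dec b i))%R%:R +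
    \sum_xn pn xn * small_mass (lprod l xn) L^-1) * expR (2 / eta) <= eta / 2.
  rewrite -ler_pdivlMr ?expR_gt0 //.
  have : eta / 2 / expR (2 / eta) = 4 * b0 by rewrite /b0; field; rewrite gt_eqF // expR_gt0.
  move=> ->; lra.
have he : e + N%:R * L * tau + eta <= 1.
  have : N%:R * L * tau <= 2 * (2 `^ (- (n%:R * (3 * a)))).
    rewrite -mulrA; apply: (@le_trans _ _ (2 * z * (L * tau))).
      by rewrite ler_pM2r // mulr_gt0 // pow2_gt0.
    rewrite -mulrA ler_pM2l // /z /L /tau -!pow2D ler_pow2.
    have : n%:R * (Hc - Hs) = n%:R * (r + 8 * a) by rewrite ea.
    lra.
  have : e = 1 - 2 * eta by rewrite /eta; field.
  lra.
have hcount : (#|{ffun 'I_n -> X}| ^ M)%:R * expR (- (N%:R / 2)) < 1 :> R.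
  rewrite card_ffun card_ord -expnM expRN ltr_pdivrMr ?expR_gt0 // mul1r.
  apply: le_lt_trans (nat_exp_le _ _ _) _; rewrite ltr_expR.
  rewrite ltr_pdivlMr // natrM; apply: le_lt_trans Nz.
  have h5 : n.+1%:R <= q * 2 `^ (n%:R * (2 * a)).
    by rewrite pow2N ler_pdivrMr ?pow2_gt0 in h4.
  have h6 : 2 * #|X|.+1%:R * n.+1%:R <= 2 `^ (n%:R * (2 * a)).
    by rewrite mulrC -ler_pdivlMr ?invr_gt0 // mulrC.
  have h7 : 2 * #|X|%:R * n%:R <= 2 `^ (n%:R * (2 * a)).
    apply: le_trans h6; rewrite -!natrM ler_nat.
    exact: leq_mul (leq_mul (leqnn 2) (leqnSn _)) (leqnSn _).
  have -> : z = 2 `^ (n%:R * r) * 2 `^ (n%:R * (2 * a)) by rewrite -pow2D -mulrDr.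
  apply: (@le_trans _ _ ((2 * #|X|%:R * n%:R) * M%:R)); first by lra.
  by rewrite [leRHS]mulrC; apply: ler_pM => //; rewrite ?mulr_ge0.
have sn0 (b : 'I_(d ^ n)) : 0 <= \prod_(i < n) s (dec b i) by apply: prodr_ge0.
have [f hf] := @oneshot_converse R {ffun 'I_n -> X} (d ^ n)
  (Un U (n := n)) (lprod l (n := n)) pn _ _ N M L tau t eta e
  (Un_unitary hU (n := n)) (fun xn b => lprod_ge0 l0 xn b)
  (fun xn => lprod_sum l1 xn) pn0 pn1 hVn
  sn0 esig isT M0
  (pow2_gt0 _) (pow2_gt0 _) (pow2_gt0 _) eta0 hmu he hcount.
(* The input that resists approximation is the empirical law of the [N] words found, not the i.i.d.
   law. *)
have [hp _] := emp_probM R f (isT : (0 < N)%N).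
apply: (res_err_ge M0 hp) => qn hq; rewrite !avgn_udu; exact: hf.
Qed.

End Asymptotics.

(** * Lower limits from eventual bounds *)

Section Limits.
Variable R : realType.

Lemma limn_einf_supE (u : nat -> \bar R) :
  limn_einf u = ereal_sup (range (einfs u)).
Proof. by rewrite limn_einf_lim; apply/cvg_lim => //; exact: cvg_einfs_sup. Qed.

Lemma limn_einf_le_near (u : nat -> \bar R) (a : \bar R) (n0 : nat) :
  (forall n, (n0 <= n)%N -> (u n <= a)%E) -> (limn_einf u <= a)%E.
Proof.
move=> h; rewrite limn_einf_supE; apply/ereal_supP => _ [m _ <-].
apply: ge_ereal_inf; exists (u (maxn m n0)); last by apply: h; exact: leq_maxr.
by exists (maxn m n0) => //; exact: leq_maxl.
Qed.

Lemma limn_einf_ge_near (u : nat -> \bar R) (a : \bar R) (n0 : nat) :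
  (forall n, (n0 <= n)%N -> (a <= u n)%E) -> (a <= limn_einf u)%E.
Proof.
move=> h; rewrite limn_einf_supE; apply: le_ereal_sup_tmp.
exists (einfs u n0); first by exists n0.
by apply/ereal_infP => _ [k hk <-]; exact: h.
Qed.

End Limits.

(** * Identification of both rates with the capacity *)

Section Rates.
Variables (R : realType) (X : finType) (d : nat) (W : X -> 'M[R[i]]_d).
Hypothesis X0 : (0 < #|X|)%N.
Hypothesis hW : forall x, density (W x).

Lemma channel_spec : exists (U : X -> 'M[R[i]]_d) (l : X -> 'I_d -> R),
  [/\ forall x, U x *m adj (U x) = 1%:M, forall x a, 0 <= l x a,
      forall x, \sum_a l x a = 1 & forall x, W x = udu (U x) (l x)].
Proof.
have /choice[Ul h] x : exists Ul : 'M[R[i]]_d * ('I_d -> R),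
    [/\ Ul.1 *m adj Ul.1 = 1%:M, W x = udu Ul.1 Ul.2, forall a, 0 <= Ul.2 a &
        \sum_a Ul.2 a = 1].
  by have [U [w [h1 h2 h3 h4]]] := density_spec (hW x); exists (U, w).
exists (fun x => (Ul x).1), (fun x => (Ul x).2).
by split=> x; case: (h x).
Qed.

(** Hides the spectral data behind what the capacity argument needs: a finite value, a uniform
    bound, and the strong converse below that value. *)
Lemma mutinf_spec (p : {ffun X -> R}) : prob p ->
  exists r : R, [/\ mutinf W p = r%:E, r <= 1 + d%:R * lgsq_max R &
    forall (r' e : R), 0 <= r' -> r' < r -> e < 1 ->
      exists n0 : nat, forall n, (n0 <= n)%N -> forall M, (0 < M)%N ->
        M%:R <= 2 `^ (n%:R * r') -> e <= res_err W n M].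
Proof.
move=> hp; have [U [l [hU l0 l1 eW]]] := channel_spec.
have [p0 p1] := hp.
have [V [s [hV es s0 s1]]] := density_spec (density_mix hW p0 p1).
exists (\sum_x p x * negent (l x) - negent s); split.
- exact: (mutinf_udu hU l0 l1 eW hp hV es).
- have : \sum_x p x * negent (l x) <= 0.
    by apply: sumr_le0 => x _; rewrite mulr_ge0_le0 // negent_le0.
  have := negent_ge s0 s1; lra.
- by move=> r' e h1 h2 h3; apply: (strong_converse hU l0 l1 eW hp hV es).
Qed.

(** The average state is [W x] itself, so the two entropies cancel; this makes the capacity
    nonnegative. *)
Lemma mutinf_dirac (x : X) : mutinf W (emp R [ffun _ : 'I_1 => x]) = 0%E.
Proof.
have [U [l [hU l0 l1 eW]]] := channel_spec.
have [hp _] := emp_probM R [ffun _ : 'I_1 => x] isT.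
have e1 (z : X -> R) : \sum_y emp R [ffun _ : 'I_1 => x] y * z y = z x.
  by rewrite emp_sumr big_ord_recl big_ord0 addr0 divr1 ffunE.
have eavg : avg W (emp R [ffun _ : 'I_1 => x]) = udu (U x) (l x).
  rewrite -eW /avg (bigD1 x) //= big1 ?addr0 => [|y yx].
    by rewrite ffunE big_ord_recl big_ord0 addr0 divr1 ffunE eqxx scale1r.
  by rewrite ffunE big_ord_recl big_ord0 addr0 divr1 ffunE eq_sym (negbTE yx) scale0r.
by rewrite (mutinf_udu hU l0 l1 eW hp (hU x) eavg) e1 subrr.
Qed.

Lemma capacity_fin : exists2 c : R, capacity W = c%:E & 0 <= c.
Proof.
have hub : (capacity W <= (1 + d%:R * lgsq_max R)%:E)%E.
  apply/ereal_supP => _ [p hp <-]; have [r [-> hr _]] := mutinf_spec hp.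
  by rewrite lee_fin.
have hlb : (0 <= capacity W)%E.
  have /card_gt0P[x _] := X0; apply: le_ereal_sup_tmp.
  exists 0%E => //; exists (emp R [ffun _ : 'I_1 => x]); last exact: mutinf_dirac.
  by case: (emp_probM R [ffun _ : 'I_1 => x] isT).
case E : (capacity W) hub hlb => [c| |] //.
by rewrite lee_fin => _ hc; exists c.
Qed.

Lemma capacity_achievability (c D e : R) : capacity W = c%:E -> 0 < D -> 0 < e ->
  exists n0 : nat, forall n, (n0 <= n)%N -> forall M, (0 < M)%N ->
    2 `^ (n%:R * (c + D)) <= 2 * M%:R -> res_err W n M <= e.
Proof.
move=> hc D0 e0; have [U [l [hU l0 l1 eW]]] := channel_spec.
have hm (p : {ffun X -> R}) : prob p -> (mutinf W p <= c%:E)%E.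
  by move=> hp; rewrite -hc; apply: ereal_sup_ubound; exists p.
have [n0 h] := achievability hU l0 l1 eW hm (divr_gt0 D0 (ltr0n R 4)) e0.
exists n0 => n hn M M0 hM; apply: h => //.
by rewrite mulrCA mulfV ?mulr1 // pnatr_eq0.
Qed.

Lemma capacity_converse (c r e : R) : capacity W = c%:E -> 0 <= r -> r < c -> e < 1 ->
  exists n0 : nat, forall n, (n0 <= n)%N -> forall M, (0 < M)%N ->
    M%:R <= 2 `^ (n%:R * r) -> e <= res_err W n M.
Proof.
move=> hc r0 rc e1.
have : (r%:E < capacity W)%E by rewrite hc lte_fin.
move=> /ereal_sup_gt[_ [p hp <-]]; have [r' [-> _ h]] := mutinf_spec hp.
by rewrite lte_fin => hr; exact: h.
Qed.

Lemma res_err_nonneg n M : (0 < M)%N -> 0 <= res_err W n M.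
Proof.
by move=> M0; have [U [l [hU l0 l1 eW]]] := channel_spec; apply: (res_err_ge0 hU l0 l1 eW).
Qed.

Lemma res_rateE : res_rate W = capacity W.
Proof.
have [c hc c_ge0] := capacity_fin; apply/eqP; rewrite eq_le; apply/andP; split.
  rewrite hc; apply/lee_addgt0Pr => g g0.
  (* A positive rate is required and [c] may be 0, hence [c + g] rather than [c]. *)
  apply: ereal_inf_lbound; exists (c + g) => //; split.
    by rewrite ltr_wpDl.
  move=> g' g'0; apply/eqP; rewrite eq_le; apply/andP; split; last first.
    apply: (@limn_einf_ge_near _ _ _ 0) => n _; rewrite lee_fin.
    apply: res_err_nonneg; have [] // := @truncn_pow2 _ n.+1 (c + g + g').
    by rewrite !addr_ge0 // ltW.
  apply/lee_addgt0Pr => e e0; rewrite add0e.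
  have [n0 h] := capacity_achievability hc (addr_gt0 g0 g'0) e0.
  apply: (@limn_einf_le_near _ _ _ n0) => n hn; rewrite lee_fin.
  have r0 : 0 <= c + g + g' by rewrite !addr_ge0 // ltW.
  have [h1 _ h2] := @truncn_pow2 _ n.+1 _ r0.
  by apply: h => //; [exact: leqW | rewrite addrA].
apply/ereal_infP => _ [r [r0 h] <-]; rewrite hc lee_fin leNgt; apply/negP => rc.
(* Half the gap keeps [r + g] below capacity, where the error is eventually at least 1/2 and its
   lower limit cannot be 0. *)
pose g := (c - r) / 2; have g0 : 0 < g by rewrite divr_gt0 // subr_gt0.
have rg : r + g < c by rewrite /g; lra.
have rg0 : 0 <= r + g by rewrite addr_ge0 // ltW.
have half1 : (1 / 2 : R) < 1 by lra.
have [n0 hn0] := capacity_converse hc rg0 rg half1.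
have : ((1 / 2 : R)%:E <= 0)%E.
  rewrite -(h g g0); apply: (@limn_einf_ge_near _ _ _ n0) => n hn; rewrite lee_fin.
  have [h1 h2 _] := @truncn_pow2 _ n.+1 _ rg0.
  by apply: hn0 => //; exact: leqW.
by rewrite lee_fin; lra.
Qed.

(** A witness [M] excludes the default value 0 of [Meps], so that logarithms are taken of a genuine
    minimum. *)
Lemma MepsP (eps : R) n M : (0 < M)%N -> res_err W n M <= eps ->
  [/\ (0 < Meps W eps n)%N, res_err W n (Meps W eps n) <= eps &
      (Meps W eps n <= M)%N].
Proof.
move=> M0 hM; rewrite /Meps; case: pselect => [h|]; last by case; exists M.
case: ex_minnP => m /asboolP[m0 hm] hmin; split => //.
by apply: hmin; apply/asboolP.
Qed.

Lemma res_rate_epsE (eps : R) : 0 < eps < 1 -> res_rate_eps W eps = capacity W.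
Proof.
move=> /andP[e0 e1]; have [c hc c_ge0] := capacity_fin.
have achieve g : 0 < g -> exists n0, forall n, (n0 <= n)%N ->
    (0 < Meps W eps n)%N /\ res_err W n (Meps W eps n) <= eps /\
    (Meps W eps n)%:R <= 2 `^ (n%:R * (c + g)) :> R.
  move=> g0; have [n0 h] := capacity_achievability hc g0 e0.
  exists n0 => n hn; have r0 : 0 <= c + g by rewrite addr_ge0 // ltW.
  have [h1 h2 h3] := @truncn_pow2 _ n _ r0.
  have [m0 m1 m2] := MepsP h1 (h n hn _ h1 h3); split => //; split => //.
  by apply: le_trans h2; rewrite ler_nat.
rewrite /res_rate_eps hc; apply/eqP; rewrite eq_le; apply/andP; split.
  apply/lee_addgt0Pr => g g0; have [n0 h] := achieve g g0.
  apply: (@limn_einf_le_near _ _ _ n0) => n hn; rewrite -EFinD lee_fin.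
  have [m0 [_ m2]] := h n.+1 (leqW hn).
  rewrite ler_pdivrMr ?ltr0n // mulrC; apply: log2_le_pow2 => //.
  by rewrite ltr0n.
have [n1 h1] := achieve 1 ltr01.
apply/lee_addgt0Pr => g g0; rewrite -leeBlDr // -EFinB.
(* The converse covers nonnegative rates only; for [c - g < 0] it suffices that [Meps] is at least
   1. *)
have [cg|cg] := ltP (c - g) 0.
  apply: (@limn_einf_ge_near _ _ _ n1) => n hn; rewrite lee_fin.
  apply: (le_trans (ltW cg)); rewrite divr_ge0 //.
  have [m0 _] := h1 n.+1 (leqW hn).
  by rewrite divr_ge0 ?(ltW (ln2_gt0 _)) // ln_ge0 // ler1n.
have cgc : c - g < c by rewrite ltrBlDr ltrDl.
(* Strictly between [eps] and 1, so that a converse error of at least [e'] contradicts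
   [res_err <= eps]. *)
pose e' := (1 + eps) / 2; have e'1 : e' < 1 by rewrite /e'; lra.
have [n2 h2] := capacity_converse hc cg cgc e'1.
apply: (@limn_einf_ge_near _ _ _ (maxn n1 n2)) => n.
rewrite geq_max => /andP[g1 g2]; rewrite lee_fin.
have [m0 [m1 _]] := h1 n.+1 (leqW g1).
rewrite ler_pdivlMr ?ltr0n // leNgt; apply/negP => hlt.
have hle : (Meps W eps n.+1)%:R <= 2 `^ (n.+1%:R * (c - g)) :> R.
  have mR : 0 < (Meps W eps n.+1)%:R :> R by rewrite ltr0n.
  by rewrite -(pow2_log2 mR) ler_pow2 mulrC ltW.
have := h2 n.+1 (leqW g2) _ m0 hle; rewrite /e'; lra.
Qed.

End Rates.

Theorem theorem1 (R : realType) (X : finType) (d : nat)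
  (W : X -> 'M[R[i]]_d) :
  (0 < #|X|)%N ->
  (forall x, density (W x)) ->
  forall eps : R, 0 < eps < 1 ->
    res_rate W = res_rate_eps W eps /\ res_rate_eps W eps = capacity W.
Proof.
move=> X0 hW eps heps; rewrite (res_rateE X0 hW) (res_rate_epsE X0 hW heps).
by split.
Qed.
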